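(* Let $K=\mathbb C$, $n\ge0$, let $U=\mathbb C^{2n}$ be the standard symplectic vector space with symplectic form $(\cdot,\cdot)$, and $\mathfrak g=\mathfrak{sp}_{2n}$. The specialized PBW deformation maps $\{F_{0,2n}(\kappa^{(1,w)}) : w\ge0\text{ even}\}$ are the same as the PBW deformation maps of type $(\mathrm{Sp}_{2n},\mathbb C^{2n},-1)$ found by Etingof–Gan–Ginzburg. That is: identify $F_{0,2n}(V)$, which is purely odd, with $U$, so that the super-symmetric square $S^2F_{0,2n}(V)$ is identified with $\Lambda^2U$, and identify $S^w\mathfrak g\simeq S^w\mathfrak g^*$ (homogeneous polynomial functions of degree $w$ on $\mathfrak g$) by means of the trace form $X\otimes Y\mapsto\mathrm{tr}(XY)$. Then for every $N\ge0$, the map $F_{0,2n}(\kappa^{(1,2N)})\colon\Lambda^2U\to S^{2N}\mathfrak g\simeq S^{2N}\mathfrak g^*$ is, up to a non-zero scalar, the map sending $v_1\otimes v_2$ to the polynomial function on $\mathfrak g$ whose value at $A\in\mathfrak g$ is the coefficient of $\tau^{2N}$ in the expansion of $$\big(v_2,\,(1-\tau^2A^2)^{-1}v_1\big)\,\det(1-\tau A)^{-1}.$$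
   Context: **Category.** Let $t=-2n$. For $k,\ell\ge0$, $A^k_\ell$ is the set of arc diagrams with $k$ upper and $\ell$ lower points (numbered left to right), i.e. perfect matchings of the $k+\ell$ points. The Brauer category with parameter $t$ has objects $V^{\otimes k}$ ($k\ge0$), $\mathrm{Hom}(V^{\otimes k},V^{\otimes\ell})$ is the $\mathbb C$-vector space with basis $A^k_\ell$, composition is vertical stacking (source on top, target at the bottom) with each closed loop replaced by a factor $t$, the tensor product is horizontal juxtaposition, and the symmetric braiding is determined by the crossing $c_{V,V}$. $\underline{\mathrm{Rep}}(O_t)$ is its additive and idempotent completion. For an object $X$, $T^nX=X^{\otimes n}$, $S^{\pm n}X$ is the image of $\sum_{\sigma\in S_n}(\pm1)^\sigma\sigma$ acting on $T^nX$ via the braiding (with $1^\sigma=1$, $(-1)^\sigma$ the sign), and $\Lambda^nX=S^{-n}X$. $s_d$ is the endomorphism of $T^{2d}V=T^d(T^2V)$ equal to $\sum_{\sigma\in S_d}\sigma\circ(\mathrm{id}-c_{V,V})^{\otimes d}$, with $\sigma$ permuting the $d$ factors $T^2V$; its image is $S^d\Lambda^2V$. **The maps $\kappa^{(\rho,w)}$.** A partition $\nu$ is a finite weakly decreasing sequence of positive integers, $\#\nu$ is the number of parts, $|\nu|$ their sum, $m_\nu(\ell)$ the multiplicity of $\ell$; $P^+$ is the set of partitions with only even parts. For $M\ge0$ and $\nu\in P^+$ let $x_{M,\nu}\in A^2_{2(M+|\nu|)}$ be the following diagram: if $M=0$ the two upper points $a,b$ are joined by an arc; if $M\ge1$, then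 with $q_1,\dots,q_{2M}$ the first $2M$ lower points there are the arcs $\{a,q_1\},\{q_2,q_3\},\dots,\{q_{2M-2},q_{2M-1}\},\{q_{2M},b\}$; then each part $\ell$ of $\nu$ in turn uses the next $2\ell$ lower points $q_1,\dots,q_{2\ell}$ with arcs $\{q_2,q_3\},\dots,\{q_{2\ell-2},q_{2\ell-1}\},\{q_1,q_{2\ell}\}$. For $\rho\in\{\pm1\}$ and $w\ge0$ with $(-1)^w=\rho$ put $$\kappa^{(\rho,w)}=\sum_{\nu\in P^+,\,|\nu|\le w}\frac{(-\rho)^{\#\nu}}{\prod_{i=1}^{\#\nu}\nu_i\,\prod_{\ell\ge1}m_\nu(\ell)!}\;s_w\circ(2x_{w-|\nu|,\nu})|_{S^{2\rho}V}\in\mathrm{Hom}(S^{2\rho}V,S^w\Lambda^2V).$$ **Specialization.** $F_{0,2n}\colon\underline{\mathrm{Rep}}(O_t)\to\mathrm{SVec}_{\mathbb C}$ is the $\mathbb C$-linear symmetric monoidal functor to supervector spaces (with the usual super braiding $a\otimes b\mapsto(-1)^{|a||b|}b\otimes a$) sending $V$ to the purely odd space $\mathbb C^{0|2n}$ with basis $e_1,\dots,e_{2n}$, the one-arc diagram $\cup\colon V\otimes V\to\mathbf 1$ to $e_i^*\otimes e_j\mapsto\delta_{ij}$ and the one-arc diagram $\cap\colon\mathbf 1\to V\otimes V$ to $1\mapsto\sum_ie_i\otimes e_i^*$, where $e_i^*=e_{i+1}$ for $i$ odd and $e_i^*=-e_{i-1}$ for $i$ even. The resulting form on $\mathbb C^{2n}$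 is symplectic and denoted $(\cdot,\cdot)$; it identifies $V_{\mathbb C}\otimes V_{\mathbb C}\simeq\mathfrak{gl}_{2n}$, under which the super exterior square $\Lambda^2F_{0,2n}(V)$ becomes $\mathfrak g=\mathfrak{sp}_{2n}$ (purely even). *)

(* Defs.v *)
From HB Require Import structures.
From mathcomp Require Import all_boot all_order all_fingroup all_algebra.
From mathcomp Require Import zify.

Set Implicit Arguments.
Unset Strict Implicit.
Unset Printing Implicit Defensive.

Import GRing.Theory.
Local Open Scope ring_scope.

(* [inl i] is the upper (source) point number i, [inr j] the lower (target)
   point number j, both counted from 0, left to right. *)
Notation point k l := ('I_k + 'I_l)%type.

(* A perfect matching is given by the fixed-point-free involution sending a
   point to the other end of its arc. *)
Record diagram (k l : nat) := Diagram {
  partner :> {ffun point k l -> point k l};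
  _ : [forall p, (partner (partner p) == p) && (partner p != p)] }.

HB.instance Definition _ k l := [isSub for @partner k l].
HB.instance Definition _ k l := [Finite of diagram k l by <:].

Fact mkdiagram_proof k l (f : point k l -> point k l) :
  involutive f -> (forall p, f p != p) ->
  [forall p, (finfun f (finfun f p) == p) && (finfun f p != p)].
Proof.
by move=> fK fN; apply/forallP=> p; rewrite !ffunE fK eqxx fN.
Qed.

Definition mkdiagram k l (f : point k l -> point k l)
    (fK : involutive f) (fN : forall p, f p != p) : diagram k l :=
  Diagram (mkdiagram_proof fK fN).

Section Stacking.
Variables (k l m : nat) (D1 : diagram k l) (D2 : diagram l m).

Notation stack_point := (('I_k + 'I_l) + 'I_m)%type.

Definition above (p : point k l) : stack_point := inl p.
Definition below (p : point l m) : stack_point :=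
  match p with inl j => inl (inr j) | inr q => inr q end.
Definition outer (p : point k m) : stack_point :=
  match p with inl i => inl (inl i) | inr q => inr q end.

Definition stack_edge : rel stack_point := fun x y =>
  [exists p, (x == above p) && (y == above (D1 p))]
  || [exists p, (x == below p) && (y == below (D2 p))].

(* Every connected component of the stacked graph is either a path between two
   outer points, i.e. an arc of the composite, or a closed loop. *)
Definition stacks_to (D : diagram k m) : bool :=
  [forall p, connect stack_edge (outer p) (outer (D p))].

Definition loops : nat :=
  n_comp stack_edge [pred x | [forall p, ~~ connect stack_edge (outer p) x]].

End Stacking.

Definition left_point k l k' l' (p : point k l) : point (k + k') (l + l') :=
  match p with inl i => inl (lshift k' i) | inr j => inr (lshift l' j) end.
Definition right_point k l k' l' (p : point k' l') : point (k + k') (l + l') :=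
  match p with inl i => inl (rshift k i) | inr j => inr (rshift l j) end.

Definition juxtaposes_to k l k' l' (D1 : diagram k l) (D2 : diagram k' l')
    (D : diagram (k + k') (l + l')) : bool :=
  [forall p, D (left_point k' l' p) == left_point k' l' (D1 p)]
  && [forall p, D (right_point k l p) == right_point k l (D2 p)].

Definition id_fun k (p : point k k) : point k k :=
  match p with inl i => inr i | inr i => inl i end.
Fact id_funK k : involutive (@id_fun k). Proof. by case. Qed.
Fact id_funN k p : @id_fun k p != p. Proof. by case: p. Qed.
Definition id_diagram k : diagram k k := mkdiagram (@id_funK k) (@id_funN k).

(* The braiding V^{(x) k} (x) V^{(x) l} -> V^{(x) l} (x) V^{(x) k}. *)
Definition cross_fun k l (p : point (k + l) (l + k)) : point (k + l) (l + k) :=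
  match p with
  | inl i => inr (match split i with
                  | inl a => rshift l a | inr b => lshift k b end)
  | inr i => inl (match split i with
                  | inl b => rshift k b | inr a => lshift l a end)
  end.
Fact cross_funK k l : involutive (@cross_fun k l).
Proof.
case=> i /=; congr (_ _); case: (splitP i) => j ij; apply: val_inj => /=.
- by rewrite -[rshift l j]/(unsplit (inr j)) unsplitK.
- by rewrite -[lshift k j]/(unsplit (inl j)) unsplitK.
- by rewrite -[rshift k j]/(unsplit (inr j)) unsplitK.
- by rewrite -[lshift l j]/(unsplit (inl j)) unsplitK.
Qed.
Fact cross_funN k l p : @cross_fun k l p != p. Proof. by case: p. Qed.
Definition cross_diagram k l : diagram (k + l) (l + k) :=
  mkdiagram (@cross_funK k l) (@cross_funN k l).

Definition cup_fun (p : point 2 0) : point 2 0 :=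
  match p with inl i => inl (rev_ord i) | inr j => inr j end.
Fact cup_funK : involutive cup_fun.
Proof. by case=> i //=; rewrite rev_ordK. Qed.
Fact cup_funN p : cup_fun p != p.
Proof. by case: p => [[[|[|]]]|[]]. Qed.
Definition cup_diagram : diagram 2 0 := mkdiagram cup_funK cup_funN.

Definition cap_fun (p : point 0 2) : point 0 2 :=
  match p with inl i => inl i | inr j => inr (rev_ord j) end.
Fact cap_funK : involutive cap_fun.
Proof. by case=> i //=; rewrite rev_ordK. Qed.
Fact cap_funN p : cap_fun p != p.
Proof. by case: p => [[]|[[|[|]]]]. Qed.
Definition cap_diagram : diagram 0 2 := mkdiagram cap_funK cap_funN.

(* Positions of the two points of the r-th factor of (T^2 V)^{(x) d}. *)
Fact fst_pos_proof d (r : 'I_d) : (r * 2 < d * 2)%N.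
Proof. by have := ltn_ord r; lia. Qed.
Fact snd_pos_proof d (r : 'I_d) : ((r * 2).+1 < d * 2)%N.
Proof. by have := ltn_ord r; lia. Qed.
Definition fst_pos d (r : 'I_d) : 'I_(d * 2) := Ordinal (fst_pos_proof r).
Definition snd_pos d (r : 'I_d) : 'I_(d * 2) := Ordinal (snd_pos_proof r).
Fact factor_proof d (i : 'I_(d * 2)) : (i %/ 2 < d)%N.
Proof. by have := ltn_ord i; lia. Qed.
Definition factor d (i : 'I_(d * 2)) : 'I_d := Ordinal (factor_proof i).

Definition move_factor d (s : {perm 'I_d}) (i : 'I_(d * 2)) : 'I_(d * 2) :=
  if odd i then snd_pos (s (factor i)) else fst_pos (s (factor i)).
Fact move_factorK d (s s' : {perm 'I_d}) :
  cancel s s' -> cancel (move_factor s) (move_factor s').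
Proof.
move=> sK i; rewrite /move_factor.
have o1 (r : 'I_d) : odd (snd_pos r) by rewrite /=; lia.
have o0 (r : 'I_d) : odd (fst_pos r) = false by rewrite /=; lia.
have f1 (r : 'I_d) : factor (snd_pos r) = r by apply: val_inj => /=; lia.
have f0 (r : 'I_d) : factor (fst_pos r) = r by apply: val_inj => /=; lia.
by case oi: (odd i); rewrite ?o1 ?o0 ?f1 ?f0 sK; apply: val_inj => /=; lia.
Qed.

(* The permutation s of the d factors T^2 V, as a diagram. *)
Definition perm_fun d (s : {perm 'I_d}) (p : point (d * 2) (d * 2)) :
    point (d * 2) (d * 2) :=
  match p with
  | inl i => inr (move_factor s i)
  | inr j => inl (move_factor s^-1%g j)
  end.
Fact perm_funK d s : involutive (@perm_fun d s).
Proof.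
by case=> i /=; rewrite move_factorK //; [apply: permK | apply: permKV].
Qed.
Fact perm_funN d s p : @perm_fun d s p != p. Proof. by case: p. Qed.
Definition perm_diagram d (s : {perm 'I_d}) : diagram (d * 2) (d * 2) :=
  mkdiagram (perm_funK s) (perm_funN s).

(* The arcs of x_{M,nu}, with points counted from 0: a, b and q_j are
   [inl 0], [inl 1] and [inr j.-1]. *)
Definition chain_arcs (M : nat) : seq ((nat + nat) * (nat + nat)) :=
  if M is 0 then [:: (inl 0, inl 1)]%N
  else (inl 0, inr 0)%N
    :: rcons [seq (inr (2 * j).-1, inr (2 * j)%N) | j <- iota 1 M.-1]
             (inr (2 * M).-1, inl 1%N).

(* A part l of nu, using the lower points o, ..., o + 2 l - 1. *)
Definition part_arcs (o l : nat) : seq ((nat + nat) * (nat + nat)) :=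
  rcons [seq (inr (o + (2 * j).-1)%N, inr (o + 2 * j)%N) | j <- iota 1 l.-1]
        (inr o, inr (o + (2 * l).-1)%N).

Fixpoint parts_arcs (o : nat) (nu : seq nat) : seq ((nat + nat) * (nat + nat)) :=
  if nu is l :: nu' then part_arcs o l ++ parts_arcs (o + 2 * l) nu' else [::].

Definition x_arcs (M : nat) (nu : seq nat) : seq ((nat + nat) * (nat + nat)) :=
  chain_arcs M ++ parts_arcs (2 * M) nu.

Definition point_nat k l (p : point k l) : nat + nat :=
  match p with inl i => inl (val i) | inr j => inr (val j) end.

Definition has_arcs k l (s : seq ((nat + nat) * (nat + nat)))
    (D : diagram k l) : bool :=
  all (fun a => [exists p, (point_nat p == a.1) && (point_nat (D p) == a.2)]) s.

Definition ends (s : seq ((nat + nat) * (nat + nat))) : seq (nat + nat) :=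
  flatten [seq [:: a.1; a.2] | a <- s].

Definition point_nats (k l : nat) : seq (nat + nat) :=
  map inl (iota 0 k) ++ map inr (iota 0 l).

Lemma point_nat_inj k l : injective (@point_nat k l).
Proof. by case=> i [] j //= [] /val_inj ->. Qed.

Lemma mem_point_nats k l c :
  reflect (exists p : point k l, point_nat p = c) (c \in point_nats k l).
Proof.
rewrite mem_cat; apply: (iffP orP) => [[c_in|c_in]|[[i|i] <-]].
- have [i] := mapP c_in; rewrite mem_iota => /= lt_i ->.
  by exists (inl (Ordinal lt_i)).
- have [i] := mapP c_in; rewrite mem_iota => /= lt_i ->.
  by exists (inr (Ordinal lt_i)).
- by left; apply/map_f; rewrite mem_iota /=.
- by right; apply/map_f; rewrite mem_iota /=.
Qed.

Lemma point_nats_uniq k l : uniq (point_nats k l).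
Proof.
rewrite cat_uniq !map_inj_uniq ?iota_uniq ?andbT //=; try by move=> ? ? [].
by apply/hasPn => _ /mapP[i _ ->]; apply/mapP => -[].
Qed.

(* Arcs whose ends enumerate all the points define exactly one diagram. *)
Lemma has_arcs_uniq k l s : perm_eq (ends s) (point_nats k l) ->
  exists D0 : diagram k l, forall D, has_arcs s D = (D == D0).
Proof.
move=> ps; have us : uniq (ends s) by rewrite (perm_uniq ps) point_nats_uniq.
have [f fP] : exists f : {ffun point k l -> point k l}, forall a, a \in s ->
    exists p q, [/\ point_nat p = a.1, point_nat q = a.2, f p = q & f q = p].
  have pre c : c \in ends s -> exists p : point k l, point_nat p == c.
    by rewrite (perm_mem ps) => /mem_point_nats[p <-]; exists p.
  elim: s us {ps} pre => [|a s IH] /=; first by exists [ffun p => p].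
  rewrite !inE negb_or -!andbA => /and4P[na1 ns1 ns2 us] pre.
  have [|f fP] := IH us; first by move=> c cs; apply: pre; rewrite !inE cs !orbT.
  have [|p /eqP pa] := pre a.1; first by rewrite !inE eqxx.
  have [|q /eqP qa] := pre a.2; first by rewrite !inE eqxx orbT.
  have npq : q != p by apply: contraNneq na1 => e; rewrite -pa -qa e.
  exists [ffun x => if x == p then q else if x == q then p else f x] => b.
  rewrite inE => /orP[/eqP->|bs].
    by exists p, q; split=> //; rewrite ffunE ?eqxx // (negPf npq).
  have [p' [q' [pb qb fp fq]]] := fP b bs.
  have sub c : c \in [:: b.1; b.2] -> c \in ends s.
    by move=> cb; apply/flattenP; exists [:: b.1; b.2] => //; apply/mapP; exists b.
  have nb1 c x : point_nat x = c -> c \in ends s -> (x == p = false) * (x == q = false).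
    move=> xc cs; split; apply/eqP => xe.
    - by move: ns1; rewrite -pa -xe xc cs.
    - by move: ns2; rewrite -qa -xe xc cs.
  have [e1 e2] := nb1 _ _ pb (sub _ (mem_head _ _)).
  have [|e3 e4] := nb1 _ _ qb (sub _ _); first by rewrite !inE eqxx orbT.
  by exists p', q'; split; rewrite // ffunE ?e1 ?e2 ?e3 ?e4.
have cov (x : point k l) : exists2 a, a \in s & point_nat x \in [:: a.1; a.2].
  have : point_nat x \in ends s.
    by rewrite (perm_mem ps); apply/mem_point_nats; exists x.
  by case/flattenP => _ /mapP[a as_ ->]; exists a.
have fD x : (f (f x) == x) && (f x != x).
  have [a as_] := cov x; have [p [q [pa qa fp fq]]] := fP a as_.
  have npq : p != q.
    apply: contraTneq us => e.
    have [s1 [s2 ->]] : exists s1 s2, s = s1 ++ a :: s2.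
      by case/splitPr: as_ => s1 s2; exists s1, s2.
    rewrite /ends map_cat flatten_cat cat_uniq /= -pa -qa e !inE eqxx.
    by rewrite !andbF.
  rewrite !inE -pa -qa => /orP[] /eqP/point_nat_inj ->; rewrite ?fp ?fq ?fp eqxx //=.
  by rewrite eq_sym.
exists (Diagram (introT forallP fD)) => D.
apply/allP/eqP => [DP|-> a as_]; last first.
  have [p [q [pa qa fp _]]] := fP a as_.
  by apply/existsP; exists p; rewrite /= fp pa qa !eqxx.
apply: val_inj; apply/ffunP => x /=.
have [a as_] := cov x; have [p [q [pa qa fp fq]]] := fP a as_.
have /existsP[p' /andP[/eqP p'a /eqP Dp'a]] := DP a as_.
have ? : p' = p by apply: (@point_nat_inj k l); rewrite p'a pa.
subst p'; have Dp : D p = q by apply: (@point_nat_inj k l); rewrite Dp'a qa.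
have Dq : D q = p.
  by rewrite -Dp; case: (D) => g /= /forallP/(_ p)/andP[/eqP].
by rewrite !inE -pa -qa => /orP[] /eqP/point_nat_inj ->; rewrite ?fp ?fq.
Qed.

Lemma ends_cat s1 s2 : ends (s1 ++ s2) = ends s1 ++ ends s2.
Proof. by rewrite /ends map_cat flatten_cat. Qed.

Lemma ends_pairs o l :
  ends [seq (inr (o + (2 * j).-1)%N, inr (o + 2 * j)%N) | j <- iota 1 l]
    = map inr (iota o.+1 (2 * l)).
Proof.
elim: l => [|l IH] //; rewrite -[l.+1]addn1 mulnDr (iotaD 1 l 1) (iotaD _ (2 * l)) !map_cat ends_cat IH.
have e1 : (o + (2 * (1 + l)).-1 = o.+1 + 2 * l)%N by lia.
have e2 : (o + 2 * (1 + l) = (o.+1 + 2 * l).+1)%N by lia.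
by congr (_ ++ _); rewrite /ends [iota _ 1]/= [map _ [:: _]]/= e1 e2 muln1.
Qed.

Lemma ends_part o l : (0 < l)%N ->
  perm_eq (ends (part_arcs o l)) (map inr (iota o (2 * l))).
Proof.
case: l => // l _; rewrite /part_arcs -cats1 ends_cat ends_pairs.
have e1 : (o + (2 * l.+1).-1 = o.+1 + 2 * l)%N by lia.
rewrite e1; have -> : (2 * l.+1 = 1 + (2 * l + 1))%N by lia.
rewrite (iotaD o 1) (iotaD _ (2 * l) 1) addn1 !map_cat perm_sym catA.
have -> : ends [:: (inr o, inr (o.+1 + 2 * l)%N)]
    = map inr (iota o 1) ++ map inr (iota (o.+1 + 2 * l) 1) by [].
by rewrite catA perm_cat2r perm_catC.
Qed.

Lemma ends_parts o nu : (0%N \notin nu) ->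
  perm_eq (ends (parts_arcs o nu)) (map inr (iota o (2 * sumn nu))).
Proof.
elim: nu o => //= l nu IH o; rewrite inE negb_or eq_sym => /andP[l0 nu0].
by rewrite ends_cat mulnDr iotaD map_cat perm_cat ?IH // ends_part // lt0n.
Qed.

Lemma ends_chain M :
  perm_eq (ends (chain_arcs M)) ([:: inl 0; inl 1]%N ++ map inr (iota 0 (2 * M))).
Proof.
case: M => [|M] //; rewrite /chain_arcs -cats1 -cat1s !ends_cat (ends_pairs 0).
have e1 : ((2 * M.+1).-1 = 1 + 2 * M)%N by lia.
rewrite e1; have -> : (2 * M.+1 = 1 + (2 * M + 1))%N by lia.
rewrite (iotaD 0 1) (iotaD _ (2 * M) 1) !map_cat /ends /= perm_cons.
by rewrite perm_sym -cat1s perm_catC /= perm_cons -catA.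
Qed.

Lemma x_arcs_uniq M nu : (0%N \notin nu) ->
  exists D0 : diagram 2 ((M + sumn nu) * 2),
    forall D, has_arcs (x_arcs M nu) D = (D == D0).
Proof.
move=> nu0; apply: has_arcs_uniq; rewrite /x_arcs ends_cat /point_nats.
rewrite [(_ * 2)%N]mulnC mulnDr (iotaD 0 (2 * M)) map_cat catA.
by apply: perm_cat; [apply: ends_chain | apply: ends_parts].
Qed.

Definition is_partition (nu : seq nat) : bool := sorted geq nu && (0%N \notin nu).
Definition Pplus (nu : seq nat) : bool :=
  is_partition nu && all (fun l => ~~ odd l) nu.

Section Brauer.
Variables (K : fieldType) (n : nat).

Definition Bhom (k l : nat) : Type := {ffun diagram k l -> K^o}.
HB.instance Definition _ k l := Vector.on (Bhom k l).

Definition basis_hom k l (D : diagram k l) : Bhom k l :=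
  [ffun D' => (D' == D)%:R].

Definition param : K := - (2 * n)%:R.

Definition Bcomp k l m (g : Bhom l m) (f : Bhom k l) : Bhom k m :=
  [ffun D => \sum_(D1 : diagram k l)
              \sum_(D2 : diagram l m | stacks_to D1 D2 D)
                param ^+ loops D1 D2 * f D1 * g D2].

Definition Btens k l k' l' (f : Bhom k l) (g : Bhom k' l') :
    Bhom (k + k') (l + l') :=
  [ffun D => \sum_(D1 : diagram k l)
              \sum_(D2 : diagram k' l' | juxtaposes_to D1 D2 D) f D1 * g D2].

Definition Bid k : Bhom k k := basis_hom (id_diagram k).
Definition Bcross k l : Bhom (k + l) (l + k) := basis_hom (cross_diagram k l).

Fixpoint Btens_pow k (f : Bhom k k) (d : nat) : Bhom (d * k) (d * k) :=
  if d is d'.+1 then Btens f (Btens_pow f d') else Bid 0.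

(* The operators whose images are S^{2 rho} V and S^d Lambda^2 V. *)
Definition sym2 (rho : int) : Bhom 2 2 := Bid 2 + rho%:~R *: Bcross 1 1.
Definition s_ (d : nat) : Bhom (d * 2) (d * 2) :=
  \sum_(s : {perm 'I_d})
    Bcomp (basis_hom (perm_diagram s)) (Btens_pow (Bid 2 - Bcross 1 1) d).

(* The target [l] is a parameter, to be taken equal to [(M + sumn nu) * 2];
   [x_arcs_uniq] then says that this is a single diagram. *)
Definition x_ (M : nat) (nu : seq nat) (l : nat) : Bhom 2 l :=
  [ffun D => (has_arcs (x_arcs M nu) D)%:R].

(* A partition of size at most w has at most w parts, each at most w. *)
Definition kappa (rho : int) (w : nat) : Bhom 2 (w * 2) :=
  \sum_(b : w.-bseq 'I_w.+1 |
        let nu := map val b in Pplus nu && (sumn nu <= w)%N)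
     let nu := map val b in
     ((- rho)%:~R ^+ size nu
        / (\prod_(l <- nu) l * \prod_(l <- undup nu) (count_mem l nu)`!)%N%:R)
     *: Bcomp (s_ w) (2%:R *: x_ (w - sumn nu) nu (w * 2)).

(* The tensor power (C^{0|2n})^{(x) k}, in coordinates: [v I] is the
   coefficient of e_{I 0} (x) ... (x) e_{I (k-1)}.  It is purely of parity
   k mod 2. *)
Notation index k := {ffun 'I_k -> 'I_(2 * n)}.
Definition T (k : nat) : Type := {ffun index k -> K^o}.
HB.instance Definition _ k := Vector.on (T k).

Definition tens k l (v : T k) (w : T l) : T (k + l) :=
  [ffun I : index (k + l) =>
    v [ffun i => I (lshift l i)] * w [ffun j => I (rshift k j)]].

Definition one_T : T 0 := [ffun=> 1].

Notation U := ('cV[K]_(2 * n)).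

Definition vec (u : U) : T 1 := [ffun I : index 1 => u (I ord0) 0].

Definition e_ (i : 'I_(2 * n)) : U := delta_mx i 0.

(* e_i^* = e_{i+1} for i odd and - e_{i-1} for i even when indices start at 1;
   here they start at 0. *)
Definition e_star (i : 'I_(2 * n)) : U :=
  \col_j (if ~~ odd i then (j == i.+1 :> nat)%:R else - (j.+1 == i :> nat)%:R).

(* A K-linear strict symmetric monoidal functor from the Brauer category to
   super vector spaces with the prescribed values on V, cup and cap.  As
   [T k] is homogeneous of parity k mod 2 and all the maps are even, the only
   sign occurs in the braiding. *)
Record specialization := Specialization {
  Fhom :> forall k l, {linear Bhom k l -> 'Hom(T k, T l)};
  F_id : forall k, Fhom k k (Bid k) = \1%VF;
  F_comp : forall k l m (g : Bhom l m) (f : Bhom k l),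
    Fhom k m (Bcomp g f) = (Fhom l m g \o Fhom k l f)%VF;
  F_tens : forall k l k' l' (f : Bhom k l) (g : Bhom k' l') (v : T k) (w : T k'),
    Fhom _ _ (Btens f g) (tens v w) = tens (Fhom k l f v) (Fhom k' l' g w);
  F_cross : forall k l (v : T k) (w : T l),
    Fhom _ _ (Bcross k l) (tens v w) = (-1) ^+ (k * l) *: tens w v;
  F_cup : forall i j,
    Fhom 2 0 (basis_hom cup_diagram) (tens (vec (e_star i)) (vec (e_ j)))
      = (i == j)%:R *: one_T;
  F_cap : Fhom 0 2 (basis_hom cap_diagram) one_T
      = \sum_i (tens (vec (e_ i)) (vec (e_star i)) : T 2) }.

(* F extends to the idempotent completion by sending the image of an
   endomorphism f proportional to an idempotent to the image of F f. *)
Section Images.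
Variable F : specialization.

Definition S2V : {vspace T 2} := limg (F 2 2 (sym2 1)).
Definition SLambda2V (w : nat) : {vspace T (w * 2)} :=
  limg (F (w * 2)%N (w * 2)%N (s_ w)).

Definition Fkappa (w : nat) : 'Hom(subvs_of S2V, subvs_of (SLambda2V w)) :=
  (linfun (vsproj (SLambda2V w)) \o F 2 (w * 2)%N (kappa 1 w)
    \o linfun vsval)%VF.

(* The vector of S^2 F(V) = Lambda^2 U represented by v1 (x) v2, that is
   v1 (x) v2 - v2 (x) v1. *)
Definition wedge (v1 v2 : U) : subvs_of S2V :=
  vsproj S2V (F 2 2 (sym2 1) (tens (vec v1) (vec v2))).

End Images.

(* Gram matrix of the form given by cup, i.e. (e_i^*, e_j) = delta_{ij}
   (see [sformE]). *)
Definition gram : 'M[K]_(2 * n) := \matrix_(i, j) (- e_star i j 0).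
Definition sform (u v : U) : K := (u^T *m gram *m v) 0 0.

Lemma sformE i j : sform (e_star i) (e_ j) = (i == j)%:R.
Proof.
rewrite /sform -colE !mxE.
case oi: (odd i).
- have lt1 : (i.-1 < 2 * n)%N by have := ltn_ord i; lia.
  rewrite (bigD1 (Ordinal lt1)) //= big1 ?addr0 => [|k ki]; rewrite !mxE oi /=.
    have -> : ~~ odd i.-1 by lia.
    have -> : i.-1.+1 = i by lia.
    by rewrite eqxx mulrNN mul1r eq_sym.
  rewrite (_ : (k.+1 == i :> nat) = false) ?oppr0 ?mul0r //.
  by apply: contraNF ki => ki; apply/eqP/val_inj => /=; lia.
- have lt1 : (i.+1 < 2 * n)%N by have := ltn_ord i; lia.
  rewrite (bigD1 (Ordinal lt1)) //= big1 ?addr0 => [|k ki].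
    by rewrite !mxE oi /= eqxx oi mul1r opprK eqSS eq_sym.
  rewrite !mxE oi /= (_ : (k == i.+1 :> nat) = false) ?mul0r //.
  by apply: contraNF ki => ki; apply/eqP/val_inj => /=; lia.
Qed.

Definition in_sp (A : 'M[K]_(2 * n)) : Prop :=
  forall u v : U, sform (A *m u) v + sform u (A *m v) = 0.

(* u (x) v as the endomorphism x |-> (v, x) u. *)
Definition gl_of (u v : U) : 'M[K]_(2 * n) := u *m (v^T *m gram).

(* The function A |-> tr(X_1 A) ... tr(X_w A) attached to
   X_1 (x) ... (x) X_w in T^w gl_{2n} = T^{2w} U, extended linearly. *)
Definition polyfun (w : nat) (y : T (w * 2)) (A : 'M[K]_(2 * n)) : K :=
  \sum_(I : {ffun 'I_(w * 2) -> 'I_(2 * n)})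
    y I * \prod_(r < w)
      \tr (gl_of (e_ (I (fst_pos r))) (e_ (I (snd_pos r))) *m A).

End Brauer.

Section Series.
Variable S : pzRingType.

Definition ps_mul (f g : nat -> S) (m : nat) : S :=
  \sum_(i < m.+1) f i * g (m - i)%N.

(* [ps_inv_seq f m] lists the coefficients m, m - 1, ..., 0 of the inverse of
   a series f with constant term 1; see [ps_invP]. *)
Fixpoint ps_inv_seq (f : nat -> S) (m : nat) : seq S :=
  if m is m'.+1 then
    let s := ps_inv_seq f m' in (- \sum_(i < m) f i.+1 * s`_i) :: s
  else [:: 1].
Definition ps_inv (f : nat -> S) (m : nat) : S := (ps_inv_seq f m)`_0.

Lemma ps_inv_seqE f m i : (i <= m)%N -> (ps_inv_seq f m)`_i = ps_inv f (m - i).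
Proof.
by elim: m i => [|m IH] [|i] //= le_im; rewrite IH.
Qed.

Lemma ps_invP f : f 0%N = 1 -> forall m, ps_mul f (ps_inv f) m = (m == 0%N)%:R.
Proof.
move=> f0 [|m]; rewrite /ps_mul big_ord_recl f0 mul1r ?big_ord0 ?addr0 //=.
rewrite subn0 {1}/ps_inv /=; apply/eqP; rewrite addrC subr_eq0; apply/eqP.
apply: eq_bigr => i _; rewrite ps_inv_seqE //; by have := ltn_ord i; lia.
Qed.

End Series.

Section EGG.
Variables (K : fieldType) (n : nat).

(* 1 - tau^2 A^2, with matrix coefficients *)
Definition resolvent_den (A : 'M[K]_(2 * n)) (m : nat) : 'M[K]_(2 * n) :=
  if m == 0%N then 1%:M else if m == 2 then - (A *m A) else 0.

(* det (1 - tau A), a polynomial in tau = 'X *)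
Definition det_poly (A : 'M[K]_(2 * n)) : {poly K} :=
  \det (1%:M - 'X *: map_mx polyC A).

(* (v2, (1 - tau^2 A^2)^{-1} v1) det(1 - tau A)^{-1} *)
Definition egg_series (v1 v2 : 'cV[K]_(2 * n)) (A : 'M[K]_(2 * n)) : nat -> K :=
  ps_mul (fun m => sform v2 (ps_inv (resolvent_den A) m *m v1))
         (ps_inv (fun m => (det_poly A)`_m)).

End EGG.

(* Main.v *)
From HB Require Import structures.
Require Import Defs.
From mathcomp Require Import all_boot all_order all_fingroup all_algebra.
From mathcomp Require Import zify ring.
From mathcomp Require Import reals complex.

(* The functional [ev A], which sends X_1 (x) ... (x) X_w to the product of the
   tr (X_r A), is invariant under permutations of the X_r and, when A is
   symplectic, under the flips of the two legs of each X_r.  It thus turns the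
   symmetrizer s_w into the scalar w! 2^w, and F(x_{M,nu}) can be evaluated
   before symmetrization.  Since sum_i e_i (x) e_i^* contracts to minus the
   identity against the form, the chain of length M gives -(v2, A^M v1) for M
   even, and a part l, which is a chain closed up by a cap, gives
   (-1)^(l-1) tr (A^l).  The sum over the partitions is then the cycle index
   expansion exp(sum_l tr(A^l) tau^l / l) = det(1 - tau A)^{-1}, where only
   even l contribute because tr (A^l) = 0 for odd l.  Both sides of this last
   identity satisfy m h_m = sum_j tr(A^j) h_{m-j}: the determinant by Jacobi's
   formula, the partition sum by removing one part. *)

Set Implicit Arguments.
Unset Strict Implicit.
Unset Printing Implicit Defensive.

Import GRing.Theory Num.Theory.
Local Open Scope ring_scope.

(** * Inverse power series and the resolvent *)

Section PowerSeries.
Variable S : pzRingType.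
Implicit Types f g : nat -> S.

(** As [f 0 = 1], the coefficient of degree m of the product is [g m] plus terms in [g] at smaller
    arguments. The bound [w] allows for a [g] that is controlled only up to degree w, as the
    partition sums below are. *)
Lemma ps_inv_unique f g w : f 0%N = 1 ->
    (forall m, (m <= w)%N -> ps_mul f g m = (m == 0%N)%:R) ->
  forall m, (m <= w)%N -> g m = ps_inv f m.
Proof.
move=> f0 fg m; have [k] := ubnP m; elim: k m => // k IH m lt_mk le_mw.
have := fg m le_mw; rewrite -(ps_invP f0 m) /ps_mul !big_ord_recl f0 !mul1r subn0.
rewrite [X in _ + X](eq_bigr (fun i : 'I_m =>
    f (lift ord0 i) * ps_inv f (m - lift ord0 i)%N)); last first.
  by move=> i _; rewrite IH //= /bump /=; have := ltn_ord i; lia.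
exact: addIr.
Qed.

End PowerSeries.

(** A geometric series in A^2: the denominator has only the coefficients 0 and 2, and their
    contributions cancel from degree 2 on. *)
Lemma ps_inv_resolvent (K : fieldType) n (A : 'M[K]_(2 * n)) m :
  ps_inv (resolvent_den A) m = if odd m then 0 else A ^+ m.
Proof.
symmetry; apply: (ps_inv_unique (w := m)
  (g := fun m => if odd m then 0 else A ^+ m)) => // {}m _.
case: m => [|[|{}m]]; rewrite /ps_mul !big_ord_recl ?big_ord0 /resolvent_den /=.
- by rewrite expr0 mulr1 addr0.
- by rewrite mulr0 mul0r !addr0.
rewrite big1 ?addr0 => [|i _]; last by rewrite /bump /= mul0r.
rewrite mul0r add0r mul1r /= subn2 /= negbK subn0 -mulmxE.
case: ifP => _; first by rewrite mulmx0 addr0.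
by rewrite !mulmxE !exprS mulrA mulNr addrN.
Qed.

(** * Jacobi's formula and Newton's identities for det(1 - tau A) *)

Lemma deriv_prod (R : comNzRingType) (I : finType) (F : I -> {poly R}) :
  (\prod_i F i)^`() = \sum_i (F i)^`() * \prod_(j | j != i) F j.
Proof.
(* The induction runs over duplicate-free lists, where the condition [j != i] drops exactly one
   factor. *)
suff H s : uniq s -> (\prod_(i <- s) F i)^`() =
    \sum_(i <- s) (F i)^`() * \prod_(j <- s | j != i) F j.
  by rewrite H ?index_enum_uniq.
elim: s => [|x s IH] /=; first by rewrite !big_nil -[1]/(1%:P) derivC.
case/andP=> xs us; rewrite !big_cons eqxx derivM IH //; congr (_ * _ + _).
  rewrite [RHS]big_seq_cond [LHS]big_seq; apply: eq_bigl => i.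
  by case is_: (i \in s) => //=; rewrite (contraNneq _ xs) // => <-.
rewrite mulr_sumr [LHS]big_seq [RHS]big_seq; apply: eq_bigr => i is_.
rewrite big_cons; case: eqP => [e|_]; last by rewrite mulrCA.
by rewrite e is_ in xs.
Qed.

(** Differentiating the Leibniz expansion gives the sum of the determinants with one row
    differentiated; expanding each along that row produces the cofactors. *)
Lemma deriv_det (R : comNzRingType) n (M : 'M[{poly R}]_n) :
  (\det M)^`() = \tr (\adj M *m map_mx (@deriv R) M).
Proof.
transitivity (\sum_i \sum_j (M i j)^`() * cofactor M i j); last first.
  rewrite exchange_big /mxtrace; apply: eq_bigr => j _; rewrite !mxE.
  by apply: eq_bigr => i _; rewrite !mxE mulrC.
transitivity (\sum_i \det (\matrix_(k, j)
    if k == i then (M k j)^`() else M k j)); last first.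
  apply: eq_bigr => i _; rewrite (expand_det_row _ i); apply: eq_bigr => j _.
  rewrite mxE eqxx /cofactor; congr (_ * (_ * \det _)).
  by apply/matrixP=> a b; rewrite !mxE eq_sym (negPf (neq_lift _ _)).
rewrite exchange_big raddf_sum; apply: eq_bigr => s _ /=.
rewrite -mulr_sumr -signr_odd; case: (odd _);
  rewrite ?mulN1r ?mul1r ?derivN deriv_prod; first congr (- _).
all: apply: eq_bigr => i _; rewrite [RHS](bigD1 i) //= mxE eqxx; congr (_ * _).
all: by apply: eq_bigr => j /negPf ji; rewrite mxE ji.
Qed.

Section Newton.
Variables (K : fieldType) (n : nat) (A : 'M[K]_(2 * n)).

Let B : 'M[{poly K}]_(2 * n) := 1%:M - 'X *: map_mx polyC A.

Lemma det_poly0 : (det_poly A)`_0 = 1.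
Proof.
rewrite -horner_coef0 /det_poly -horner_evalE -det_map_mx.
rewrite (_ : map_mx _ _ = 1%:M) ?det1 //; apply/matrixP=> i j.
rewrite !mxE rmorphB rmorphM rmorph_nat /= /horner_eval hornerX mul0r subr0.
by [].
Qed.

(** The adjugate is det(B) times the inverse of B, a geometric series in tau A. Instead of inverting
    B, the proof reads a recursion on the coefficients off [B *m \adj B]. *)
Lemma coef_adj_resolvent k :
  map_mx (coefp k) (\adj B) = \sum_(j < k.+1) (det_poly A)`_(k - j) *: A ^+ j.
Proof.
have BE : B *m \adj B = (det_poly A)%:M by rewrite mul_mx_adj.
have rec i : map_mx (coefp i) (\adj B) = ((det_poly A)`_i)%:M +
    (if i is i'.+1 then A *m map_mx (coefp i') (\adj B) else 0).
  have /(congr1 (map_mx (coefp i))) := BE.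
  rewrite mulmxBl mul1mx -scalemxAl map_mxB => /eqP; rewrite subr_eq => /eqP->.
  congr (_ + _); first by apply/matrixP=> a b; rewrite !mxE /= coefMn.
  apply/matrixP=> a b; case: i => [|i]; rewrite !mxE /= coefXM //= coef_sum.
  by apply: eq_bigr => c _; rewrite !mxE /= coefCM.
elim: k => [|k IH]; rewrite rec.
  by rewrite big_ord1 subnn expr0 addr0 -scalemx1.
rewrite big_ord_recl subn0 expr0 -scalemx1 IH mulmx_sumr; congr (_ + _).
by apply: eq_bigr => j _; rewrite -scalemxAr exprS -mulmxE subSS.
Qed.

Lemma newton_det k : (det_poly A)^`()`_k =
  - \sum_(j < k.+1) (det_poly A)`_(k - j) * \tr (A ^+ j.+1).
Proof.
rewrite /det_poly deriv_det.
have -> : map_mx (@deriv K) B = - map_mx polyC A.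
  apply/matrixP=> i j; rewrite !mxE derivB derivM derivX derivC mulr0 addr0.
  by rewrite mul1r -polyC_natr derivC sub0r.
rewrite mulmxN raddfN /= coefN; congr (- _).
transitivity (\tr (map_mx (coefp k) (\adj B) *m A)).
  rewrite /mxtrace coef_sum; apply: eq_bigr => i _; rewrite !mxE coef_sum.
  by apply: eq_bigr => j _; rewrite !mxE coefMC.
rewrite coef_adj_resolvent mulmx_suml raddf_sum; apply: eq_bigr => j _ /=.
by rewrite -scalemxAl mxtraceZ exprSr mulmxE.
Qed.

End Newton.

Lemma coefM_congr (R : nzRingType) (p p' q q' : {poly R}) k :
  (forall i, (i <= k)%N -> p`_i = p'`_i) ->
  (forall i, (i <= k)%N -> q`_i = q'`_i) -> (p * q)`_k = (p' * q')`_k.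
Proof.
move=> pp' qq'; rewrite !coefM; apply: eq_bigr => i _.
by rewrite pp' ?qq' ?leq_subr // -ltnS.
Qed.

(** The recursion says h' = p h for the generating series h of [H] and p of the traces, while
    [newton_det] says E' = - E p for E = det(1 - tau A). Hence (E h)' = 0 and, in characteristic 0,
    E h = 1. As h and p are cut off near degree w, these equations are used only below w. *)
Lemma ps_inv_newton (K : numFieldType) n (A : 'M[K]_(2 * n)) (H : nat -> K) w :
  H 0%N = 1 ->
  (forall m, (m < w)%N ->
     m.+1%:R * H m.+1 = \sum_(j < m.+1) \tr (A ^+ j.+1) * H (m - j)%N) ->
  forall m, (m <= w)%N -> H m = ps_inv (fun m => (det_poly A)`_m) m.
Proof.
move=> H0 rec; apply: ps_inv_unique; first exact: det_poly0.
pose E := det_poly A; pose h := \poly_(i < w.+1) H i.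
pose p := \poly_(i < w) \tr (A ^+ i.+1).
have hE i : (i <= w)%N -> h`_i = H i by rewrite coef_poly ltnS => ->.
have pE i : (i < w)%N -> p`_i = \tr (A ^+ i.+1) by rewrite coef_poly => ->.
have dE i : (i < w)%N -> E^`()`_i = (- (E * p))`_i.
  move=> lt_iw; rewrite /E newton_det coefN coefMr; congr (- _).
  by apply: eq_bigr => j _; rewrite pE //; have := ltn_ord j; lia.
have dh i : (i < w)%N -> h^`()`_i = (p * h)`_i.
  move=> lt_iw; rewrite coef_deriv hE // -mulr_natl rec // coefM.
  by apply: eq_bigr => j _; rewrite pE ?hE //; have := ltn_ord j; lia.
move=> m le_mw; transitivity ((E * h)`_m).
  rewrite coefM /ps_mul; apply: eq_bigr => i _; rewrite hE //.
  by have := ltn_ord i; lia.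
case: m le_mw => [|m] lt_mw; first by rewrite coef0M hE // det_poly0 H0 mulr1.
have : (E * h)^`()`_m = 0; last first.
  by rewrite coef_deriv => /eqP; rewrite mulrn_eq0 /= => /eqP.
rewrite derivM coefD.
rewrite (@coefM_congr _ _ (- (E * p)) _ h) => [||//]; last first.
  by move=> i le_im; apply: dE; lia.
rewrite (@coefM_congr _ E E _ (p * h)) => [|//|]; last first.
  by move=> i le_im; apply: dh; lia.
by rewrite mulrA mulNr coefN addNr.
Qed.

(** * Partitions and the cycle index expansion of det(1 - tau A)^{-1} *)

Definition centralizer_order (nu : seq nat) : nat :=
  (\prod_(l <- nu) l * \prod_(l <- undup nu) (count_mem l nu)`!)%N.

Lemma leq_sumn (nu : seq nat) l : l \in nu -> (l <= sumn nu)%N.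
Proof.
by elim: nu => //= a nu IH; rewrite inE => /orP[/eqP->|/IH]; lia.
Qed.

Lemma sumn_count (nu : seq nat) B : (sumn nu < B)%N ->
  sumn nu = (\sum_(l < B) l * count_mem (l : nat) nu)%N.
Proof.
elim: nu => /= [|a nu IH] ltB; first by rewrite big1 // => i _; rewrite muln0.
rewrite [X in (_ + X)%N]IH; last lia.
under [RHS]eq_bigr do rewrite mulnDr; rewrite big_split /=; congr (_ + _)%N.
have lt_aB : (a < B)%N by lia.
rewrite (bigD1 (Ordinal lt_aB)) //= eqxx muln1 big1 ?addn0 // => i ia.
rewrite [a == i](_ : _ = false) ?muln0 //; apply: contraNF ia => /eqP ai.
by apply/eqP/val_inj.
Qed.

(** Absent parts contribute 0! = 1, so the product may run over a range independent of [nu];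
    removing a part then changes a single factor. *)
Lemma prod_fact_count (nu : seq nat) B : (sumn nu < B)%N ->
  (\prod_(l <- undup nu) (count_mem l nu)`!
    = \prod_(l < B) (count_mem (l : nat) nu)`!)%N.
Proof.
move=> ltB; rewrite -(big_mkord xpredT (fun l => (count_mem l nu)`!)%N).
rewrite [RHS](bigID (mem nu)) /= [X in (_ * X)%N]big1 ?muln1; last first.
  by move=> l /count_memPn ->.
rewrite -[RHS]big_filter; apply: perm_big; apply: uniq_perm.
- exact: undup_uniq.
- by rewrite filter_uniq ?iota_uniq.
move=> l; rewrite mem_undup mem_filter mem_index_iota /=.
by case: (boolP (l \in nu)) => // /leq_sumn; lia.
Qed.

Lemma sumn_rem (nu : seq nat) l : l \in nu -> sumn nu = (l + sumn (rem l nu))%N.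
Proof. by move=> l_nu; rewrite (perm_sumn (perm_to_rem l_nu)). Qed.

(** One copy of l is lost from the product of the parts, and m! becomes (m - 1)! for its
    multiplicity m. *)
Lemma centralizer_order_rem (nu : seq nat) l : l \in nu ->
  centralizer_order nu
    = (l * count_mem l nu * centralizer_order (rem l nu))%N.
Proof.
move=> l_nu; have lt_l : (l < (sumn nu).+1)%N by rewrite ltnS leq_sumn.
have sum_rem := sumn_rem l_nu.
rewrite /centralizer_order (perm_big _ (perm_to_rem l_nu)) big_cons /=.
rewrite !(@prod_fact_count _ (sumn nu).+1); try lia.
rewrite !(bigD1 (Ordinal lt_l) (P := xpredT)) //= count_rem l_nu /= eqxx.
under [X in (_ = _ * (_ * (_ * X)))%N]eq_bigr => i il.
  rewrite count_rem l_nu /= (_ : (l == i) = false) ?subn0; last first.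
    by apply: contraNF il => /eqP li; apply/eqP/val_inj.
  over.
have : (0 < count_mem l nu)%N by rewrite -has_count has_pred1.
case: (count_mem l nu) => // c _; rewrite factS subn1 /=.
by rewrite mulnCA !mulnA; lia.
Qed.

Lemma centralizer_order_gt0 (nu : seq nat) :
  0%N \notin nu -> (0 < centralizer_order nu)%N.
Proof.
move=> nu0; rewrite muln_gt0; apply/andP; split.
  rewrite big_seq prodn_cond_gt0 // => l l_nu; rewrite lt0n.
  by apply: contraNneq nu0 => <-.
by rewrite prodn_gt0 // => l; rewrite fact_gt0.
Qed.

Lemma partition_eq (mu nu : seq nat) :
  is_partition mu -> is_partition nu -> perm_eq mu nu -> mu = nu.
Proof.
case/andP=> s1 _ /andP[s2 _]; apply: sorted_eq s1 s2.
  by move=> y x z; rewrite /geq /=; lia.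
by move=> x y; rewrite /geq /=; lia.
Qed.

Lemma partition_rem (nu : seq nat) l : is_partition nu -> is_partition (rem l nu).
Proof.
case/andP=> s0 n0; apply/andP; split.
  by apply: subseq_sorted (rem_subseq l nu) s0 => y x z; rewrite /geq /=; lia.
by apply: contra n0; apply: mem_rem.
Qed.

Section PartitionSum.
Variable w : nat.

(** The index set of [kappa], seen as sequences of natural numbers so that parts can be removed and
    inserted. It contains every partition of size at most w. *)
Definition bounded_seqs : seq (seq nat) :=
  [seq map val (val b) | b <- enum {: w.-bseq 'I_w.+1}].

Lemma bounded_seqs_uniq : uniq bounded_seqs.
Proof.
rewrite map_inj_uniq ?enum_uniq // => b c /(inj_map val_inj) bc.
exact: val_inj.
Qed.

Lemma mem_bounded_seqs (nu : seq nat) :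
  (size nu <= w)%N -> {in nu, forall l, (l <= w)%N} -> nu \in bounded_seqs.
Proof.
move=> le_size le_w; apply/mapP.
have le_size' : (size (map (@inord w) nu) <= w)%N by rewrite size_map.
exists (Bseq le_size'); first by rewrite mem_enum.
rewrite /= -map_comp -[LHS]map_id; apply/eq_in_map => l l_nu.
by rewrite /= inordK // ltnS le_w.
Qed.

Lemma partition_bounded (nu : seq nat) :
  is_partition nu -> (sumn nu <= w)%N -> nu \in bounded_seqs.
Proof.
case/andP=> _ nu0 le_w; apply: mem_bounded_seqs => [|l /leq_sumn]; last lia.
apply: leq_trans le_w; elim: nu nu0 => //= l nu IH.
by rewrite inE negb_or => /andP[l0 /IH]; lia.
Qed.

Variables (K : numFieldType) (p : nat -> K).

Definition partition_weight (nu : seq nat) : K :=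
  (\prod_(l <- nu) p l) / (centralizer_order nu)%:R.

(** For m <= w and [p l] the power sums, this is the complete homogeneous symmetric function h_m. *)
Definition partition_sum (m : nat) : K :=
  \sum_(nu <- bounded_seqs | is_partition nu && (sumn nu == m))
    partition_weight nu.

Lemma partition_sum0 : partition_sum 0 = 1.
Proof.
have -> : partition_sum 0 = \sum_(nu <- [:: [::]]) partition_weight nu.
  rewrite /partition_sum -big_filter; apply: perm_big; apply: uniq_perm => //.
    by rewrite filter_uniq ?bounded_seqs_uniq.
  move=> nu; rewrite mem_filter inE; case: nu => [|l nu] /=.
    by rewrite mem_bounded_seqs.
  apply/negP; rewrite /is_partition inE negb_or.
  by case/andP=> /andP[/and3P[_ l0 _] /eqP]; lia.
by rewrite big_seq1 /partition_weight /centralizer_order !big_nil divr1.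
Qed.

Lemma partition_weight_rem nu l : is_partition nu -> l \in nu ->
  (l * count_mem l nu)%:R * partition_weight nu
    = p l * partition_weight (rem l nu).
Proof.
move=> nu_part l_nu; have /andP[_ nu0] := nu_part.
have := centralizer_order_gt0 nu0; rewrite /partition_weight.
rewrite (perm_big _ (perm_to_rem l_nu)) big_cons /=.
rewrite (centralizer_order_rem l_nu) natrM muln_gt0 => /andP[h1 h2].
field; rewrite !pnatr_eq0 -!lt0n h2 /= andbC -muln_gt0; exact: h1.
Qed.

(** Removing one l is a bijection from the partitions of m having l as a part onto the partitions of
    m - l; the inverse inserts l and sorts. *)
Lemma partition_sum_rem m l : (m <= w)%N -> (0 < l <= m)%N ->
  \sum_(nu <- bounded_seqs | [&& is_partition nu, sumn nu == m & l \in nu])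
    partition_weight (rem l nu) = partition_sum (m - l).
Proof.
move=> le_mw /andP[l0 le_lm].
rewrite -big_filter -(big_map (rem l) xpredT) /partition_sum -[RHS]big_filter.
apply: perm_big; apply: uniq_perm.
- rewrite map_inj_in_uniq ?filter_uniq ?bounded_seqs_uniq // => mu nu.
  rewrite !mem_filter => /andP[/and3P[mu1 _ mu2] _] /andP[/and3P[nu1 _ nu2] _] e.
  apply: partition_eq => //; rewrite (permPl (perm_to_rem mu2)) e perm_sym.
  exact: perm_to_rem.
- by rewrite filter_uniq ?bounded_seqs_uniq.
move=> mu; rewrite mem_filter.
apply/mapP/andP => [[nu]|[/andP[mu_part /eqP smu] _]].
  rewrite mem_filter => /andP[/and3P[nu_part /eqP snu l_nu] _] ->.
  have := sumn_rem l_nu; split; last first.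
    by apply: partition_bounded; [exact: partition_rem | lia].
  by rewrite partition_rem //=; lia.
have perm_nu : perm_eq (sort geq (l :: mu)) (l :: mu) by rewrite perm_sort.
have l_nu : l \in sort geq (l :: mu) by rewrite mem_sort mem_head.
have nu_part : is_partition (sort geq (l :: mu)).
  rewrite /is_partition sort_sorted => [|x y]; last by rewrite /geq /=; lia.
  rewrite mem_sort inE negb_or; have /andP[_ ->] := mu_part; lia.
exists (sort geq (l :: mu)).
  rewrite mem_filter nu_part l_nu (perm_sumn perm_nu) /= smu.
  rewrite partition_bounded ?(perm_sumn perm_nu) //=; lia.
apply: partition_eq => //; first exact: partition_rem.
by rewrite -(perm_cons l) perm_sym -(permPl (perm_to_rem l_nu)).
Qed.

(** Write m + 1 as the sum over l of l times the multiplicity of l in nu, apply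
    [partition_weight_rem] to each term, and exchange the two sums. *)
Lemma partition_sum_rec m : (m < w)%N ->
  m.+1%:R * partition_sum m.+1
    = \sum_(j < m.+1) p j.+1 * partition_sum (m - j)%N.
Proof.
move=> lt_mw; pose P nu := is_partition nu && (sumn nu == m.+1).
transitivity (\sum_(nu <- bounded_seqs | P nu) \sum_(j < m.+1 | j.+1 \in nu)
    p j.+1 * partition_weight (rem j.+1 nu)).
  rewrite mulr_sumr; apply: eq_bigr => nu /andP[nu_part /eqP snu].
  rewrite -{1}snu (@sumn_count nu m.+2) ?snu // big_ord_recl mul0n add0n.
  rewrite natr_sum mulr_suml [RHS]big_mkcond /=; apply: eq_bigr => j _.
  rewrite /bump /= add1n; case: ifP => [|/negbT/count_memPn->].
    exact: partition_weight_rem.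
  by rewrite muln0 mul0r.
rewrite (exchange_big_dep xpredT) //=; apply: eq_bigr => j _.
rewrite -mulr_sumr; congr (_ * _); have := ltn_ord j => lt_jm.
rewrite -[(m - j)%N]/(m.+1 - j.+1)%N -(@partition_sum_rem m.+1 j.+1) //.
by apply: eq_bigl => nu; rewrite -andbA.
Qed.

End PartitionSum.

Lemma partition_sum_det (K : numFieldType) n (A : 'M[K]_(2 * n)) w m :
  (m <= w)%N ->
  partition_sum w (fun l => \tr (A ^+ l)) m = ps_inv (fun i => (det_poly A)`_i) m.
Proof.
apply: ps_inv_newton; first exact: partition_sum0.
exact: partition_sum_rec.
Qed.

(** * The symplectic form and powers of symplectic matrices *)

Section Symplectic.
Variables (K : numFieldType) (n : nat).
Notation G := (gram K n).
Notation U := ('cV[K]_(2 * n)).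
Implicit Types (u v x : U) (A : 'M[K]_(2 * n)).

Lemma gramT : G^T = - G.
Proof.
apply/matrixP=> i j; rewrite !mxE.
have ne (a b : 'I_(2 * n)) : odd a = odd b -> (a.+1 == b :> nat) = false.
  by move=> ab; apply/eqP; lia.
case oi: (odd i); case oj: (odd j) => /=; rewrite ?opprK 1?eq_sym //.
- by rewrite [j == _ :> nat]eq_sym !ne ?oi ?oj // oppr0.
- by rewrite [j == _ :> nat]eq_sym !ne ?oi ?oj // oppr0.
Qed.

Lemma e_star_col i : e_star K i = col i G.
Proof.
apply/colP=> j; rewrite [RHS]mxE.
have := congr1 (fun M : 'M_(2 * n) => M i j) gramT; rewrite [LHS]mxE => ->.
by rewrite [RHS]mxE [G i j]mxE opprK.
Qed.

Lemma sform_e i x : sform (e_ K i) x = (G *m x) i 0.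
Proof. by rewrite /sform /e_ trmx_delta -mulmxA -rowE mxE. Qed.

(** The columns of G are the [e_star i], so [sformE] reads G^T G = 1; skew-symmetry turns this into
    G^2 = -1. *)
Lemma gram_sqr : G *m G = - 1%:M.
Proof.
apply: oppr_inj; rewrite opprK -mulNmx -gramT; apply/matrixP=> i j.
rewrite [RHS]mxE -sformE /sform e_star_col tr_col -row_mul /e_ -colE.
by rewrite [RHS]mxE [RHS]mxE.
Qed.

Lemma sformC u v : sform u v = - sform v u.
Proof.
have -> : sform u v = ((u^T *m G *m v)^T) 0 0 by rewrite [RHS]mxE.
rewrite !trmx_mul trmxK gramT mulmxA mulmxN mulNmx.
by rewrite [LHS]mxE.
Qed.

Lemma sform_linear u : linear (sform u : U -> K^o).
Proof. by move=> a x y; rewrite /sform mulmxDr -scalemxAr !mxE. Qed.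
HB.instance Definition _ u :=
  GRing.isLinear.Build K U K^o _ (sform u) (sform_linear u).

Lemma sform_e_star i x : sform (e_star K i) x = x i 0.
Proof.
rewrite /sform e_star_col tr_col gramT -mulmxA rowE -!mulmxA mulNmx.
by rewrite [G *m (G *m x)]mulmxA gram_sqr mulNmx opprK mul1mx -rowE mxE.
Qed.

Lemma col_sum_e x : x = \sum_i x i 0 *: e_ K i.
Proof.
apply/colP=> j; rewrite summxE (bigD1 j) //= big1 ?addr0.
  by rewrite !mxE !eqxx mulr1.
by move=> i /negPf ij; rewrite !mxE eq_sym ij mulr0.
Qed.

(** The sum is G G x. It contracts the first leg of a cap against x, and its sign is the factor -1
    that each cap contributes to a chain. *)
Lemma sum_sform_e_e_star x : \sum_i sform (e_ K i) x *: e_star K i = - x.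
Proof.
rewrite -[in RHS](mul1mx x) -mulNmx -gram_sqr -mulmxA.
apply/colP=> j; rewrite summxE mxE; apply: eq_bigr => i _.
by rewrite sform_e e_star_col !mxE mulrC.
Qed.

Lemma bilinear_entry (M : 'M[K]_(2 * n)) i j :
  ((e_ K i)^T *m M *m e_ K j) 0 0 = M i j.
Proof. by rewrite /e_ trmx_delta -rowE -colE !mxE. Qed.

Lemma in_sp_gram A : in_sp A -> G *m A = - (A^T *m G).
Proof.
move=> spA; apply/eqP; rewrite -addr_eq0; apply/eqP/matrixP=> i j.
have := spA (e_ K i) (e_ K j); rewrite /sform trmx_mul mulmxA.
rewrite -(mulmxA _ A^T G) -(mulmxA _ G A) !bilinear_entry addrC => h.
by rewrite [LHS]mxE [RHS]mxE.
Qed.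

Lemma sform_in_sp A u v : in_sp A -> sform u (A *m v) = sform v (A *m u).
Proof.
by move=> /(_ u v)/eqP; rewrite addrC addr_eq0 => /eqP->; rewrite -sformC.
Qed.

(** An element of sp is minus its own adjoint for the form, so its k-th power is its own adjoint up
    to (-1)^k. *)
Lemma gram_exp A k : in_sp A -> G *m A ^+ k = (-1) ^+ k *: ((A ^+ k)^T *m G).
Proof.
move=> spA; elim: k => [|k IH].
  by rewrite !expr0 trmx1 mulmx1 mul1mx scale1r.
rewrite exprS -mulmxE mulmxA in_sp_gram // mulNmx -mulmxA IH -scalemxAr.
by rewrite mulmxA -trmx_mul mulmxE -exprSr -exprS (exprS (-1)) mulN1r scaleNr.
Qed.

(** Even powers of A are self-adjoint and the form is skew. This is what makes the chain value a
    function on the exterior square of U. *)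
Lemma sform_exp_even A u v m : in_sp A -> ~~ odd m ->
  sform u (A ^+ m *m v) = - sform v (A ^+ m *m u).
Proof.
move=> spA em; rewrite -sformC /sform trmx_mul -mulmxA [G *m _]mulmxA.
by rewrite gram_exp // -signr_odd (negPf em) scale1r !mulmxA.
Qed.

(** For odd m, G A^m G is the transpose of A^m, while its trace is also -tr(A^m) because G^2 =
    -1. *)
Lemma mxtrace_exp_odd A m : in_sp A -> odd m -> \tr (A ^+ m) = 0.
Proof.
move=> spA om.
have : \tr (G *m A ^+ m *m G) = \tr ((A ^+ m)^T).
  rewrite gram_exp // -signr_odd om scaleN1r mulNmx -mulmxA gram_sqr.
  by rewrite mulmxN mulmx1 opprK.
rewrite mxtrace_tr mxtrace_mulC mulmxA gram_sqr mulNmx mul1mx linearN /=.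
move/eqP; rewrite eq_sym -subr_eq0 opprK -mulr2n -[_ *+ _]mulr_natl.
by rewrite mulf_eq0 pnatr_eq0 /= => /eqP.
Qed.

End Symplectic.

(** * Tensor powers in coordinates and the evaluation functional *)

Section Tensors.
Variables (K : numFieldType) (n : nat).
Notation U := ('cV[K]_(2 * n)).
Notation index k := {ffun 'I_k -> 'I_(2 * n)}.
Notation T k := (T K n k).
Notation e_ := (e_ K).

Definition delta_T k (I : index k) : T k := [ffun J => (J == I)%:R].

Lemma sum_delta_T k (v : T k) : v = \sum_I v I *: delta_T I.
Proof.
apply/ffunP=> J; rewrite sum_ffunE (bigD1 J) //= big1 ?addr0.
  by rewrite !ffunE eqxx [_ *: _]mulr1.
by move=> I /negPf IJ; rewrite !ffunE eq_sym IJ scaler0.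
Qed.

Definition lindex k l (I : index (k + l)) : index k := [ffun i => I (lshift l i)].
Definition rindex k l (I : index (k + l)) : index l := [ffun i => I (rshift k i)].
Definition join_index k l (I : index k) (J : index l) : index (k + l) :=
  [ffun i => match split i with inl a => I a | inr b => J b end].

Lemma join_indexK1 k l (I : index k) (J : index l) : lindex (join_index I J) = I.
Proof. by apply/ffunP=> i; rewrite !ffunE (unsplitK (inl i)). Qed.

Lemma join_indexK2 k l (I : index k) (J : index l) : rindex (join_index I J) = J.
Proof. by apply/ffunP=> i; rewrite !ffunE (unsplitK (inr i)). Qed.

Lemma lrindexK k l (I : index (k + l)) : join_index (lindex I) (rindex I) = I.
Proof.
apply/ffunP=> i; rewrite ffunE -[in RHS](splitK i).
by case: (split i) => j; rewrite ffunE.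
Qed.

Lemma tensE k l (v : T k) (w : T l) I : tens v w I = v (lindex I) * w (rindex I).
Proof. by rewrite ffunE. Qed.

Lemma tens_delta k l (I : index (k + l)) :
  tens (delta_T (lindex I)) (delta_T (rindex I)) = delta_T I.
Proof.
apply/ffunP=> J; rewrite tensE !ffunE -natrM mulnb; congr ((nat_of_bool _)%:R).
apply/andP/eqP=> [[/eqP lIJ /eqP rIJ]|-> //].
by rewrite -[LHS]lrindexK lIJ rIJ lrindexK.
Qed.

Lemma big_index k l (f : index (k + l) -> K) :
  \sum_I f I = \sum_(I : index k) \sum_(J : index l) f (join_index I J).
Proof.
rewrite pair_big (reindex (fun IJ : index k * index l => join_index IJ.1 IJ.2)) //.
exists (fun I => (lindex I, rindex I)) => [[I J] _|I _] /=.
  by rewrite join_indexK1 join_indexK2.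
exact: lrindexK.
Qed.

Lemma big_index1 (f : index 1 -> K) : \sum_I f I = \sum_i f [ffun=> i].
Proof.
rewrite (reindex (fun i => [ffun=> i] : index 1)) //.
exists (fun I : index 1 => I ord0) => [i _|I _]; first by rewrite ffunE.
by apply/ffunP=> i; rewrite (ord1 i) ffunE.
Qed.

Lemma tens_suml k l (w : T l) (J : finType) (f : J -> T k) (c : J -> K) :
  tens (\sum_j c j *: f j) w = \sum_j c j *: tens (f j) w.
Proof.
apply/ffunP=> I; rewrite tensE !sum_ffunE mulr_suml; apply: eq_bigr => j _.
by rewrite !ffunE; apply: esym; apply: mulrA.
Qed.

Lemma tens_sumr k l (v : T k) (J : finType) (f : J -> T l) (c : J -> K) :
  tens v (\sum_j c j *: f j) = \sum_j c j *: tens v (f j).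
Proof.
apply/ffunP=> I; rewrite tensE !sum_ffunE mulr_sumr; apply: eq_bigr => j _.
by rewrite !ffunE; apply: mulrCA.
Qed.

Lemma vec_sum (J : finType) (f : J -> U) (c : J -> K) :
  vec (\sum_j c j *: f j) = \sum_j c j *: vec (f j).
Proof.
apply/ffunP=> I; rewrite !ffunE summxE sum_ffunE; apply: eq_bigr => j _.
by rewrite !ffunE mxE.
Qed.

Lemma delta_T1 (I : index 1) : delta_T I = vec (e_ (I ord0)).
Proof.
apply/ffunP=> J; rewrite !ffunE mxE andbT; congr ((nat_of_bool _)%:R).
apply/eqP/eqP => [-> //|IJ]; apply/ffunP=> i; by rewrite ord1.
Qed.

Section Evaluation.
Variable A : 'M[K]_(2 * n).

(* The factor [sform (e_ b) (A *m e_ a)] is [tr (gl_of (e_ a) (e_ b) *m A)]; an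
   unpaired last index is ignored. *)
Fixpoint trace_pairs (s : seq 'I_(2 * n)) : K :=
  if s is a :: b :: s' then sform (e_ b) (A *m e_ a) * trace_pairs s' else 1.

(** Defined for every [k] and not only for [w * 2], because the pieces of a diagram come with
    lengths such as [1 + (M * 2 + 1)]. It agrees with [polyfun] by [polyfun_ev]. *)
Definition ev k (y : T k) : K^o := \sum_I y I * trace_pairs (codom I).

Fact ev_linear k : linear (@ev k).
Proof.
move=> a u v; rewrite -[RHS]/(a * ev u + ev v) /ev mulr_sumr -big_split /=.
by apply: eq_bigr => I _; rewrite !ffunE mulrDl mulrA.
Qed.
HB.instance Definition _ k :=
  GRing.isLinear.Build K (T k) K^o _ (@ev k) (@ev_linear k).

Lemma codom_join k l (I : index k) (J : index l) :
  codom (join_index I J) = codom I ++ codom J.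
Proof.
rewrite !codomE.
have -> : enum 'I_(k + l)
    = map (@lshift k l) (enum 'I_k) ++ map (@rshift k l) (enum 'I_l).
  apply: (inj_map val_inj); rewrite [LHS]val_enum_ord iotaD add0n map_cat.
  congr (_ ++ _); rewrite -map_comp.
    by rewrite -val_enum_ord; apply: eq_map.
  by rewrite -[k in LHS]addn0 iotaDl -val_enum_ord -map_comp; apply: eq_map.
rewrite map_cat -!map_comp; congr (_ ++ _); apply: eq_map => i /=.
  by rewrite ffunE (unsplitK (inl i)).
by rewrite ffunE (unsplitK (inr i)).
Qed.

Lemma codom1 (I : index 1) : codom I = [:: I ord0].
Proof. by rewrite codomE enum_ordSl /= (size0nil (size_enum_ord 0)). Qed.

(** Evenness of the first length keeps a pair from straddling the boundary. *)
Lemma trace_pairs_cat s t : ~~ odd (size s) ->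
  trace_pairs (s ++ t) = trace_pairs s * trace_pairs t.
Proof.
have [m] := ubnP (size s); elim: m s => // m IH [|a [|b s]] //= lt_m.
  by rewrite mul1r.
by rewrite negbK => es; rewrite IH ?mulrA //; lia.
Qed.

Lemma ev_tens k l (v : T k) (w : T l) : ~~ odd k ->
  ev (tens v w) = ev v * ev w.
Proof.
move=> ek; rewrite /ev big_index mulr_suml; apply: eq_bigr => I _.
rewrite mulr_sumr; apply: eq_bigr => J _.
rewrite tensE join_indexK1 join_indexK2 codom_join trace_pairs_cat.
  exact: mulrACA.
by rewrite size_codom card_ord.
Qed.

Lemma ev_vec2 (u v : U) : ev (tens (vec u) (vec v) : T 2) = sform v (A *m u).
Proof.
rewrite /ev (@big_index 1 1) big_index1.
under eq_bigr do rewrite big_index1.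
have -> : sform v (A *m u) = (v^T *m (gram K n *m A) *m u) 0 0.
  by rewrite /sform !mulmxA.
rewrite mxE; apply: eq_bigr => i _; rewrite mxE mulr_suml.
apply: eq_bigr => j _; rewrite (@tensE 1 1) join_indexK1 join_indexK2.
rewrite (@codom_join 1 1) !codom1 /= !ffunE mulr1.
rewrite sform_e mulmxA /Defs.e_ -colE.
rewrite [col _ _ _ _]mxE [v^T _ _]mxE.
ring.
Qed.

Lemma ev_one : ev (one_T K n) = 1.
Proof.
rewrite /ev; under eq_bigr do
  rewrite ffunE mul1r codomE (size0nil (size_enum_ord 0)) /=.
by rewrite sumr_const card_ffun !card_ord expn0.
Qed.

Lemma polyfun_ev w (y : T (w * 2)) : polyfun y A = ev y.
Proof.
rewrite /polyfun /ev; apply: eq_bigr => I _; congr (_ * _).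
elim: w {y} I => [|w IH] I.
  by rewrite big_ord0 codomE (size0nil (size_enum_ord 0)).
have -> : codom I = codom (@lindex 2 (w * 2) I) ++ codom (@rindex 2 (w * 2) I).
  by rewrite -codom_join lrindexK.
rewrite trace_pairs_cat; last by rewrite size_codom card_ord.
rewrite -IH big_ord_recl; congr (_ * _).
  rewrite codomE !enum_ordSl (size0nil (size_enum_ord 0)) /= !ffunE mulr1.
  rewrite /gl_of -!mulmxA mxtrace_mulC trace_mx11 /sform -!mulmxA.
  have -> : fst_pos ord0 = @lshift 2 (w * 2) ord0 by apply: val_inj.
  by have -> : snd_pos ord0 = @lshift 2 (w * 2) (lift ord0 ord0) by apply: val_inj.
apply: eq_bigr => r _; rewrite !ffunE.
have -> : fst_pos (lift ord0 r) = @rshift 2 (w * 2) (fst_pos r) by apply: val_inj.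
have -> : snd_pos (lift ord0 r) = @rshift 2 (w * 2) (snd_pos r).
  exact: val_inj.
by [].
Qed.

End Evaluation.
End Tensors.

(** * Juxtaposition and loop-free composition of diagrams *)

Lemma partnerK k l (D : diagram k l) : involutive D.
Proof. by case: D => f /= /forallP fP p; have /andP[/eqP] := fP p. Qed.

Lemma partner_neq k l (D : diagram k l) p : D p != p.
Proof. by case: D => f /= /forallP fP; have /andP[] := fP p. Qed.

Lemma diagramP k l (D D' : diagram k l) : D =1 D' -> D = D'.
Proof. by move=> e; apply: val_inj; apply/ffunP. Qed.

Lemma mkdiagramE k l (f : point k l -> point k l) (fK : involutive f)
  (fN : forall p, f p != p) : mkdiagram fK fN =1 f.
Proof. by move=> p; rewrite /= ffunE. Qed.

Section Juxtaposition.
Variables k l k' l' : nat.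

Definition split_point (p : point (k + k') (l + l')) : point k l + point k' l' :=
  match p with
  | inl i => match split i with inl a => inl (inl a) | inr b => inr (inl b) end
  | inr i => match split i with inl a => inl (inr a) | inr b => inr (inr b) end
  end.
Definition unsplit_point (p : point k l + point k' l') : point (k + k') (l + l') :=
  match p with inl q => left_point k' l' q | inr q => right_point k l q end.

Lemma split_pointK : cancel split_point unsplit_point.
Proof.
by case=> i /=; rewrite -[in RHS](splitK i); case: (split i).
Qed.

Lemma unsplit_pointK : cancel unsplit_point split_point.
Proof.
case=> [[i|i]|[i|i]] /=.
- by rewrite (unsplitK (inl i)).
- by rewrite (unsplitK (inl i)).
- by rewrite (unsplitK (inr i)).
- by rewrite (unsplitK (inr i)).
Qed.

Variables (D1 : diagram k l) (D2 : diagram k' l').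

Definition juxtapose_fun (p : point (k + k') (l + l')) : point (k + k') (l + l') :=
  unsplit_point
    match split_point p with inl q => inl (D1 q) | inr q => inr (D2 q) end.

Fact juxtapose_funK : involutive juxtapose_fun.
Proof.
move=> p; rewrite /juxtapose_fun unsplit_pointK -[RHS]split_pointK.
by case: (split_point p) => q; rewrite partnerK.
Qed.

Fact juxtapose_funN p : juxtapose_fun p != p.
Proof.
rewrite (can2_eq unsplit_pointK split_pointK).
case: (split_point p) => q; apply/eqP=> -[] /eqP;
  by rewrite (negPf (partner_neq _ _)).
Qed.

Definition juxtapose : diagram (k + k') (l + l') :=
  mkdiagram juxtapose_funK juxtapose_funN.

Lemma juxtapose_left q : juxtapose (left_point k' l' q) = left_point k' l' (D1 q).
Proof. by rewrite mkdiagramE /juxtapose_fun (unsplit_pointK (inl q)). Qed.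

Lemma juxtapose_right q : juxtapose (right_point k l q) = right_point k l (D2 q).
Proof. by rewrite mkdiagramE /juxtapose_fun (unsplit_pointK (inr q)). Qed.

Lemma juxtaposes_toP D : juxtaposes_to D1 D2 D = (D == juxtapose).
Proof.
apply/andP/eqP => [[/forallP h1 /forallP h2]|->]; last first.
  by split; apply/forallP=> q; rewrite ?juxtapose_left ?juxtapose_right.
apply: diagramP => p; rewrite -[p]split_pointK; case: (split_point p) => q /=.
  by rewrite juxtapose_left; apply/eqP.
by rewrite juxtapose_right; apply/eqP.
Qed.

Definition shift_point (c : nat + nat) : nat + nat :=
  match c with inl i => inl (k + i)%N | inr j => inr (l + j)%N end.

Lemma has_arcs_juxtapose s1 s2 : has_arcs s1 D1 -> has_arcs s2 D2 ->
  has_arcs (s1 ++ [seq (shift_point a.1, shift_point a.2) | a <- s2]) juxtapose.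
Proof.
rewrite /has_arcs all_cat => /allP h1 /allP h2; apply/andP; split; apply/allP.
  move=> a /h1 /existsP[p /andP[/eqP <- /eqP <-]]; apply/existsP.
  exists (left_point k' l' p); rewrite juxtapose_left.
  by case: p => i; case: (D1 _) => j /=; rewrite !eqxx.
move=> _ /mapP[a /h2 /existsP[p /andP[/eqP <- /eqP <-]] ->]; apply/existsP.
exists (right_point k l p); rewrite juxtapose_right.
by case: p => i; case: (D2 _) => j /=; rewrite !eqxx.
Qed.

End Juxtaposition.

Lemma sum_basis_hom (K : fieldType) k l (D0 : diagram k l) (f : diagram k l -> K) :
  \sum_D f D * basis_hom K D0 D = f D0.
Proof.
rewrite (bigD1 D0) //= ffunE eqxx mulr1 big1 ?addr0 // => D /negPf DD0.
by rewrite ffunE DD0 mulr0.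
Qed.

Lemma Btens_basis (K : fieldType) k l k' l'
    (D1 : diagram k l) (D2 : diagram k' l') :
  Btens (basis_hom K D1) (basis_hom K D2) = basis_hom K (juxtapose D1 D2).
Proof.
apply/ffunP=> D; rewrite !ffunE.
transitivity (\sum_D1' \sum_D2'
   ((juxtaposes_to D1' D2' D)%:R * basis_hom K D1 D1') * basis_hom K D2 D2').
  apply: eq_bigr => D1' _; rewrite big_mkcond; apply: eq_bigr => D2' _ /=.
  by case: ifP => _; rewrite ?mul1r ?mul0r.
under eq_bigr do rewrite sum_basis_hom.
by rewrite sum_basis_hom juxtaposes_toP.
Qed.

(* When all the upper points of the lower diagram are joined to lower points, no
   closed loop can appear, and every stack point lies on the path of the outer
   point [lab x]. *)
Section ThroughComposition.
Variables (k l m : nat) (D1 : diagram k l) (D2 : diagram l m) (f : 'I_l -> 'I_m).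
Hypothesis D2f : forall j, D2 (inl j) = inr (f j).

Definition through_point (p : point k l) : point k m :=
  match p with inl i => inl i | inr j => inr (f j) end.

Lemma through_injective : injective f.
Proof.
move=> i j ij; suff [] : (inl i : point l m) = inl j by [].
by rewrite -[LHS](partnerK D2) D2f ij -D2f partnerK.
Qed.

Definition through_fun (p : point k m) : point k m :=
  match p with
  | inl i => through_point (D1 (inl i))
  | inr q => match D2 (inr q) with
             | inl j => through_point (D1 (inr j))
             | inr q' => inr q'
             end
  end.

Lemma through_fun_point p : through_fun (through_point p) = through_point (D1 p).
Proof. by case: p => // j /=; rewrite -D2f partnerK. Qed.

Lemma D2_inl q j : D2 (inr q) = inl j -> f j = q.
Proof. by move=> e; have := D2f j; rewrite -e partnerK => -[]. Qed.

Lemma D2_inrK q q' : D2 (inr q) = inr q' -> D2 (inr q') = inr q.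
Proof. by move=> <-; rewrite partnerK. Qed.

Fact through_funK : involutive through_fun.
Proof.
case=> [i|q] /=; first by rewrite through_fun_point partnerK.
case e: (D2 (inr q)) => [j|q'] /=; last by rewrite (D2_inrK e).
by rewrite through_fun_point partnerK /= (D2_inl e).
Qed.

Lemma through_point_inj : injective through_point.
Proof. by case=> i [] j // [] => [->|/through_injective ->]. Qed.

Fact through_funN p : through_fun p != p.
Proof.
case: p => [i|q].
  rewrite /= -[X in _ != X]/(through_point (inl i)) (inj_eq through_point_inj).
  exact: partner_neq.
rewrite /=; case e: (D2 (inr q)) => [j|q'].
  rewrite -(D2_inl e) -[X in _ != X]/(through_point (inr j)).
  by rewrite (inj_eq through_point_inj) partner_neq.
by apply: contra_eq_neq e => -[->]; rewrite partner_neq.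
Qed.

Definition through_diagram : diagram k m := mkdiagram through_funK through_funN.

Lemma through_diagramE : through_diagram =1 through_fun.
Proof. exact: mkdiagramE. Qed.

Lemma through_diagram_inr q q' :
  D2 (inr q) = inr q' -> through_diagram (inr q) = inr q'.
Proof. by rewrite through_diagramE /= => ->. Qed.

Let D := through_diagram.
Let E := stack_edge D1 D2.

Let lab (x : 'I_k + 'I_l + 'I_m) : point k m :=
  match x with inl p => through_point p | inr q => inr q end.

(** An edge of the upper diagram, or one between two lower points, passes to the other end of an arc
    of [D]; an edge between the middle row and the bottom keeps the label. Hence a component of the
    stack carries the labels of a single arc. *)
Let lab_edge x y : E x y -> lab y = lab x \/ lab y = D (lab x).
Proof.
case/orP=> /existsP[p /andP[/eqP-> /eqP->]].
  by right; rewrite mkdiagramE /= through_fun_point.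
case: p => [j|q]; first by left; rewrite D2f.
rewrite mkdiagramE; case e: (D2 (inr q)) => [j|q'] /=.
  by left; rewrite (D2_inl e).
by right; rewrite e.
Qed.

Let lab_connect x y : connect E x y -> lab y = lab x \/ lab y = D (lab x).
Proof.
case/connectP=> s; elim: s x => [|z s IH] x /=; first by move=> _ ->; left.
case/andP=> /lab_edge xz /IH h /h [->|->] //.
by case: xz => ->; [right | left; rewrite partnerK].
Qed.

Let edge_below p : E (below k p) (below k (D2 p)).
Proof. by apply/orP; right; apply/existsP; exists p; rewrite !eqxx. Qed.

Let edge_above p : E (above m p) (above m (D1 p)).
Proof. by apply/orP; left; apply/existsP; exists p; rewrite !eqxx. Qed.

Let outer_lab x : connect E x (outer l (lab x)) /\ connect E (outer l (lab x)) x.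
Proof.
case: x => [[i|j]|q] /=; try by split; apply: connect0.
split; apply: connect1.
  by have := edge_below (inl j); rewrite D2f.
by have := edge_below (D2 (inl j)); rewrite partnerK D2f.
Qed.

Let outer_partner p : connect E (outer l p) (outer l (D p)).
Proof.
case: p => [i|q]; rewrite mkdiagramE /=.
  have := connect1 (edge_above (inl i)) => /connect_trans; apply.
  exact: (outer_lab (above m (D1 (inl i)))).1.
have := edge_below (inr q); case: (D2 (inr q)) => [j|q'] /connect1 //.
move/connect_trans; apply.
have := connect1 (edge_above (inr j)) => /connect_trans; apply.
exact: (outer_lab (above m (D1 (inr j)))).1.
Qed.

Lemma stacks_to_through D' : stacks_to D1 D2 D' = (D' == D).
Proof.
apply/forallP/eqP => [h|->] //; apply: diagramP => p.
have := lab_connect (h p).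
have labK q : lab (outer l q) = q by case: q.
rewrite !labK => -[/eqP|//]; by rewrite (negPf (partner_neq _ _)).
Qed.

Lemma loops_through : loops D1 D2 = 0%N.
Proof.
rewrite /loops /n_comp_mem eq_card0 // => x.
rewrite !inE /=; apply/andP=> -[_ /forallP/(_ (lab x))/negP]; apply.
by case: (outer_lab x).
Qed.

Lemma Bcomp_through (K : fieldType) n :
  Bcomp n (basis_hom K D2) (basis_hom K D1) = basis_hom K D.
Proof.
apply/ffunP=> D'; rewrite !ffunE.
transitivity (\sum_D1' \sum_D2'
   (((stacks_to D1' D2' D')%:R * param K n ^+ loops D1' D2')
     * basis_hom K D2 D2') * basis_hom K D1 D1').
  apply: eq_bigr => D1' _; rewrite big_mkcond; apply: eq_bigr => D2' _ /=.
  case: ifP => _; rewrite ?mul1r ?mul0r //; exact: mulrAC.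
under eq_bigr do rewrite -mulr_suml sum_basis_hom.
by rewrite sum_basis_hom loops_through mulr1 stacks_to_through.
Qed.

End ThroughComposition.

(** * Permutations of the factors T^2 V *)

Lemma move_factorE d (s : {perm 'I_d}) i :
  move_factor s i = (s (factor i) * 2 + odd i)%N :> nat.
Proof. by rewrite /move_factor; case: (odd i); rewrite /= ?addn0 ?addn1. Qed.

Lemma factor_move d (s : {perm 'I_d}) i : factor (move_factor s i) = s (factor i).
Proof. by apply: val_inj; rewrite /= move_factorE; case: (odd i) => /=; lia. Qed.

Lemma odd_move d (s : {perm 'I_d}) i : odd (move_factor s i) = odd i.
Proof. by rewrite move_factorE; case: (odd i) => /=; lia. Qed.

Lemma move_factorM d (s t : {perm 'I_d}) i :
  move_factor (s * t) i = move_factor t (move_factor s i).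
Proof.
apply: val_inj; rewrite /= move_factorE [RHS]move_factorE.
by rewrite factor_move odd_move permM.
Qed.

Lemma id_diagramE k : id_diagram k =1 @id_fun k.
Proof. exact: mkdiagramE. Qed.

Lemma cross_diagramE k l : cross_diagram k l =1 @cross_fun k l.
Proof. exact: mkdiagramE. Qed.

Lemma perm_diagramE d (s : {perm 'I_d}) : perm_diagram s =1 perm_fun s.
Proof. exact: mkdiagramE. Qed.

(** A product of permutations acts by its left factor first, as does the composite with the diagram
    of [s] on top. *)
Lemma Bcomp_perm (K : fieldType) n d (s t : {perm 'I_d}) :
  Bcomp n (basis_hom K (perm_diagram t)) (basis_hom K (perm_diagram s))
    = basis_hom K (perm_diagram (s * t)).
Proof.
have tE j : perm_diagram t (inl j) = inr (move_factor t j) by rewrite perm_diagramE.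
rewrite (Bcomp_through _ tE); congr (basis_hom K _); apply: diagramP => p.
rewrite mkdiagramE perm_diagramE; case: p => [i|q] /=.
  by rewrite perm_diagramE /= move_factorM.
by rewrite !perm_diagramE /= perm_diagramE /= invMg move_factorM.
Qed.

Lemma perm_diagram0 (s : {perm 'I_0}) : perm_diagram s = id_diagram 0.
Proof. by apply: diagramP => -[[]|[]]. Qed.

Lemma move_lift_left d (s : {perm 'I_d}) (i : 'I_2) :
  move_factor (lift0_perm s) (@lshift 2 (d * 2) i : 'I_(d.+1 * 2))
    = @lshift 2 (d * 2) i.
Proof.
apply: val_inj => /=; rewrite move_factorE /=.
have -> : factor (@lshift 2 (d * 2) i : 'I_(d.+1 * 2)) = 0.
  by apply: val_inj => /=; have := ltn_ord i; lia.
by rewrite lift0_perm0 /=; have := ltn_ord i; lia.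
Qed.

Lemma move_lift_right d (s : {perm 'I_d}) (i : 'I_(d * 2)) :
  move_factor (lift0_perm s) (@rshift 2 (d * 2) i : 'I_(d.+1 * 2))
    = @rshift 2 (d * 2) (move_factor s i).
Proof.
apply: val_inj => /=; rewrite !move_factorE /=.
have -> : factor (@rshift 2 (d * 2) i : 'I_(d.+1 * 2)) = lift 0 (factor i).
  by apply: val_inj => /=; rewrite /bump /=; lia.
rewrite lift0_perm_lift /= /bump /=; lia.
Qed.

Lemma juxtapose_lift d (s : {perm 'I_d}) :
  juxtapose (id_diagram 2) (perm_diagram s) = perm_diagram (lift0_perm s).
Proof.
apply: diagramP => p; rewrite -[p](@split_pointK 2 2 (d * 2) (d * 2)).
apply: (etrans _ (esym (perm_diagramE (lift0_perm s) _))).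
case: (split_point p) => [[i|i]|[i|i]].
- apply: (etrans (juxtapose_left (id_diagram 2) (perm_diagram s) (inl i))).
  rewrite id_diagramE /=.
  by rewrite move_lift_left.
- apply: (etrans (juxtapose_left (id_diagram 2) (perm_diagram s) (inr i))).
  rewrite id_diagramE /=.
  by rewrite [(lift0_perm s)^-1%g]lift_permV move_lift_left.
- apply: (etrans (juxtapose_right (id_diagram 2) (perm_diagram s) (inl i))).
  rewrite perm_diagramE /=.
  by rewrite move_lift_right.
- apply: (etrans (juxtapose_right (id_diagram 2) (perm_diagram s) (inr i))).
  rewrite perm_diagramE /=.
  by rewrite [(lift0_perm s)^-1%g]lift_permV move_lift_right.
Qed.

(** The transposition of the first two factors is a braiding tensored with an identity, so the
    axioms of [specialization] determine its image. *)
Lemma juxtapose_cross d :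
  juxtapose (cross_diagram 2 2) (id_diagram (d * 2))
    = perm_diagram (tperm (ord0 : 'I_d.+2) (lift ord0 ord0)).
Proof.
set s := tperm _ _.
have f0 (i : 'I_2) : factor (lshift (d * 2) (lshift 2 i) : 'I_(d.+2 * 2)) = ord0.
  by apply: val_inj => /=; have := ltn_ord i; lia.
have f1 (i : 'I_2) :
    factor (lshift (d * 2) (rshift 2 i) : 'I_(d.+2 * 2)) = lift ord0 ord0.
  by apply: val_inj => /=; rewrite /bump /=; have := ltn_ord i; lia.
have m0 (i : 'I_2) : move_factor s (lshift (d * 2) (lshift 2 i) : 'I_(d.+2 * 2))
    = lshift (d * 2) (rshift 2 i).
  apply: val_inj => /=; rewrite move_factorE f0 tpermL /= /bump /=.
  have := ltn_ord i; lia.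
have m1 (i : 'I_2) : move_factor s (lshift (d * 2) (rshift 2 i) : 'I_(d.+2 * 2))
    = lshift (d * 2) (lshift 2 i).
  apply: val_inj => /=; rewrite move_factorE f1 tpermR /=; have := ltn_ord i; lia.
have m2 i : move_factor s (@rshift (2 + 2) (d * 2) i : 'I_(d.+2 * 2))
    = @rshift (2 + 2) (d * 2) i.
  apply: val_inj => /=; rewrite move_factorE tpermD /=; first by lia.
    by apply/eqP=> /(congr1 val) /=; lia.
  by apply/eqP=> /(congr1 val) /=; rewrite /bump /=; lia.
apply: diagramP => p; rewrite -[p](@split_pointK (2 + 2) (2 + 2) (d * 2) (d * 2)).
apply: (etrans _ (esym (perm_diagramE s _))).
case: (split_point p) => [[i|i]|[i|i]].
- apply: (etrans (juxtapose_left (cross_diagram 2 2) (id_diagram (d * 2)) (inl i))).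
  rewrite cross_diagramE /=.
  by rewrite -[in RHS](@splitK 2 2 i); case: (split i) => j /=; rewrite (m0, m1).
- apply: (etrans (juxtapose_left (cross_diagram 2 2) (id_diagram (d * 2)) (inr i))).
  rewrite cross_diagramE /=.
  rewrite tpermV -[in RHS](@splitK 2 2 i).
  by case: (split i) => j /=; rewrite (m0, m1).
- apply: (etrans (juxtapose_right (cross_diagram 2 2) (id_diagram (d * 2)) (inl i))).
  rewrite id_diagramE /=.
  by rewrite m2.
- apply: (etrans (juxtapose_right (cross_diagram 2 2) (id_diagram (d * 2)) (inr i))).
  rewrite id_diagramE /=.
  by rewrite tpermV m2.
Qed.

Lemma perm_lift0 d (s : {perm 'I_d.+1}) : s ord0 = ord0 ->
  exists t : {perm 'I_d}, s = lift0_perm t.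
Proof.
move=> s0.
have ne i : ord0 != s (lift ord0 i) by rewrite -{1}s0 (inj_eq perm_inj) neq_lift.
pose f i := odflt i (unlift ord0 (s (lift ord0 i))).
have fE i : lift ord0 (f i) = s (lift ord0 i).
  by have [j e eu] := unlift_some (ne i); rewrite /f eu e.
have finj : injective f.
  move=> i j ij; apply: (@lift_inj _ ord0); apply: (@perm_inj _ s).
  by rewrite -!fE ij.
exists (perm finj); apply/permP=> i; case: (unliftP ord0 i) => [j|] ->.
  by rewrite -fE lift0_perm_lift permE.
by rewrite s0 lift0_perm0.
Qed.

(** An induction principle adapted to the functor: the diagrams of a lift and of the first
    transposition are tensor products of simpler ones, and products of permutations are
    compositions. *)
Lemma perm_head_ind (P : forall d, {perm 'I_d} -> Prop) :
  (forall s, P 0%N s) ->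
  (forall d (s : {perm 'I_d}), P d s -> P d.+1 (lift0_perm s)) ->
  (forall d, P d.+2 (tperm ord0 (lift ord0 ord0))) ->
  (forall d (s t : {perm 'I_d}), P d s -> P d t -> P d (s * t)%g) ->
  forall d s, P d s.
Proof.
move=> P0 PS P2 PM; elim=> // d IH s.
have fixed (t : {perm 'I_d.+1}) : t ord0 = ord0 -> P d.+1 t.
  by move=> /perm_lift0[t' ->]; apply: PS.
have [s0|s0] := eqVneq (s ord0) ord0; first exact: fixed.
case: d => [|d] in IH s fixed s0 *; first by rewrite [s ord0]ord1 in s0.
have [|k sk _] := @unlift_some _ ord0 (s ord0); first by rewrite eq_sym.
(* The product [s * t * r] sends 0 to [lift ord0 k], then to 1, then to 0, so it is a lift; as [t]
   and [r] are involutions, multiplying by [r * t] recovers [s]. *)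
set t := lift0_perm (tperm k ord0).
pose r := tperm (ord0 : 'I_d.+2) (lift ord0 ord0).
have tt : (t * t)%g = 1%g by rewrite /t /lift0_perm lift_permM tperm2 lift_perm1.
have -> : s = (s * t * r * (r * t))%g.
  by rewrite !mulgA -(mulgA _ r r) tperm2 mulg1 -mulgA tt mulg1.
apply: (PM); last by apply: (PM); [exact: P2 | apply: (PS); exact: IH].
by apply: fixed; rewrite !permM sk lift0_perm_lift tpermL tpermR.
Qed.

(** * The symmetrizer under the evaluation functional *)

Section TensorUnits.
Variables (K : numFieldType) (n : nat).
Notation T k := (T K n k).

Lemma tens_one_r (u : T 2) : (tens u (one_T K n) : T 2) = u.
Proof.
apply/ffunP=> I; rewrite (@tensE _ _ 2 0) ffunE mulr1; congr (u _).
by apply/ffunP=> i; rewrite ffunE; congr (I _); apply: val_inj.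
Qed.

Lemma tens_one_l k (u : T k) : (tens (one_T K n) u : T k) = u.
Proof.
apply/ffunP=> I; rewrite (@tensE _ _ 0 k) ffunE mul1r; congr (u _).
by apply/ffunP=> i; rewrite ffunE; congr (I _); apply: val_inj.
Qed.

(** Pairs the first leg of a cap with the vector to its left, the shape on which [ev_tens] acts. *)
Lemma tens_regroup m (u a b : T 1) (y : T m) :
  (tens u (tens (tens a b) y) : T m.+3) = tens (tens u a) (tens b y).
Proof.
apply/ffunP=> I; rewrite (@tensE _ _ 1 m.+2) (@tensE _ _ 2 m) (@tensE _ _ 1 1).
rewrite (@tensE _ _ 2 m.+1) (@tensE _ _ 1 1 u) (@tensE _ _ 1 m b) !mulrA.
congr (u _ * a _ * b _ * y _); apply/ffunP=> i; rewrite !ffunE; congr (I _);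
  exact: val_inj.
Qed.

End TensorUnits.

Section Evaluation.
Variables (K : numFieldType) (n : nat) (F : specialization K n).
Variables (A : 'M[K]_(2 * n)) (spA : in_sp A).
Notation T k := (T K n k).

Lemma ev_lfun_ext k l (f : 'Hom(T k, T l)) (c : K) :
  (forall I, ev A (f (delta_T K I)) = c * ev A (delta_T K I)) ->
  forall y, ev A (f y) = c * ev A y.
Proof.
move=> h y; rewrite [y]sum_delta_T !linear_sum mulr_sumr; apply: eq_bigr => I _.
by rewrite !linearZ /= h; apply: mulrCA.
Qed.

Lemma ev_Btens k l k' l' (f : Bhom K k l) (g : Bhom K k' l') (c c' : K) :
  ~~ odd k -> ~~ odd l ->
  (forall y, ev A (F k l f y) = c * ev A y) ->
  (forall y, ev A (F k' l' g y) = c' * ev A y) ->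
  forall y, ev A (F (k + k')%N (l + l')%N (Btens f g) y) = c * c' * ev A y.
Proof.
move=> ek el hf hg; apply: ev_lfun_ext => I.
by rewrite -tens_delta F_tens !ev_tens // hf hg mulrACA.
Qed.

Lemma ev_Bid k y : ev A (F k k (Bid K k) y) = 1 * ev A y.
Proof. by rewrite F_id id_lfunE mul1r. Qed.

(** The square T^2 V is even, so its braiding carries no sign, and the values of the two factors
    commute. *)
Lemma ev_cross22 y : ev A (F (2 + 2)%N (2 + 2)%N (Bcross K 2 2) y) = 1 * ev A y.
Proof.
move: y; apply: ev_lfun_ext => I.
rewrite -(@tens_delta _ _ 2 2) F_cross [_ ^+ _](_ : _ = 1); last first.
  by rewrite -signr_odd.
by rewrite scale1r mul1r !ev_tens // mulrC.
Qed.

Lemma ev_perm d (s : {perm 'I_d}) y :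
  ev A (F (d * 2)%N (d * 2)%N (basis_hom K (perm_diagram s)) y) = ev A y.
Proof.
rewrite -[RHS]mul1r; move: y.
apply: (perm_head_ind (P := fun d s => forall y,
    ev A (F (d * 2)%N (d * 2)%N (basis_hom K (perm_diagram s)) y) = 1 * ev A y))
  => {d s} [s|d s IH|d|d s t hs ht].
- by rewrite perm_diagram0; apply: ev_Bid.
- have := @ev_Btens 2 2 _ _ _ _ _ _ isT isT (@ev_Bid 2) IH.
  by rewrite Btens_basis juxtapose_lift mul1r.
- have := @ev_Btens 4 4 _ _ _ _ _ _ isT isT ev_cross22 (@ev_Bid (d * 2)).
  by rewrite Btens_basis juxtapose_cross mul1r.
- by move=> y; rewrite -(Bcomp_perm _ n) F_comp comp_lfunE ht hs !mul1r.
Qed.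

Lemma F_cross_vec u v :
  F 2 2 (Bcross K 1 1) (tens (vec u) (vec v)) = - (tens (vec v) (vec u) : T 2).
Proof. by have := @F_cross _ _ F 1 1 (vec u) (vec v); rewrite expr1 scaleN1r. Qed.

(** The odd parity of V makes id - c send u (x) v to u (x) v + v (x) u, and (v, A u) is symmetric in
    u and v for symplectic A. *)
Lemma ev_antisym2 (y : T 2) :
  ev A (F 2 2 (Bid K 2 - Bcross K 1 1) y) = 2%:R * ev A y.
Proof.
move: y; apply: ev_lfun_ext => I.
rewrite -(@tens_delta _ _ 1 1) !delta_T1 linearB /= add_lfunE opp_lfunE.
rewrite [F 2 2 (Bid K 2)]F_id id_lfunE F_cross_vec opprK linearD /=.
by rewrite !ev_vec2 [X in _ + X]sform_in_sp // mulr_natl mulr2n.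
Qed.

Lemma ev_antisym d (y : T (d * 2)) :
  ev A (F (d * 2)%N (d * 2)%N (Btens_pow (Bid K 2 - Bcross K 1 1) d) y)
    = 2%:R ^+ d * ev A y.
Proof.
elim: d y => [|d IH]; first exact: ev_Bid.
by rewrite exprS; apply: (@ev_Btens 2 2 (d * 2) (d * 2)) => //; apply: ev_antisym2.
Qed.

Lemma ev_s d (y : T (d * 2)) :
  ev A (F (d * 2)%N (d * 2)%N (s_ K n d) y) = (d`!)%:R * 2%:R ^+ d * ev A y.
Proof.
rewrite /s_ linear_sum sum_lfunE linear_sum.
under eq_bigr do rewrite F_comp comp_lfunE /= ev_perm ev_antisym.
by rewrite sumr_const -mulrA mulr_natl -card_Sn.
Qed.

(** * Evaluation of chains, cups and single parts *)

Fixpoint tail_diagram M : diagram 1 (M * 2 + 1) :=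
  if M is M'.+1 then juxtapose cap_diagram (tail_diagram M') else id_diagram 1.

(** The chain of length M + 1: a through strand, M caps and another through strand. The chain of
    length 0 is the cup and is treated apart. *)
Definition chain_diagram M : diagram 2 (1 + (M * 2 + 1)) :=
  juxtapose (id_diagram 1) (tail_diagram M).

(** Each induction step absorbs the leftmost cap, which replaces u by -A u through
    [sum_sform_e_e_star]. *)
Lemma ev_tail M u v :
  ev A (tens (vec u) (F 1 _ (basis_hom K (tail_diagram M)) (vec v)))
    = (-1) ^+ M * sform v (A ^+ M.+1 *m u).
Proof.
elim: M u => [|M IH] u; first by rewrite [F 1 _ _]F_id id_lfunE ev_vec2 mul1r.
have -> : F 1 _ (basis_hom K (tail_diagram M.+1)) (vec v)
    = tens (F 0 2 (basis_hom K cap_diagram) (one_T K n))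
        (F 1 _ (basis_hom K (tail_diagram M)) (vec v)).
  by rewrite -F_tens Btens_basis tens_one_l.
rewrite F_cap.
under eq_bigr do rewrite -[tens _ _]scale1r.
rewrite tens_suml tens_sumr linear_sum.
transitivity (\sum_i sform (e_ K i) (A *m u) *
    ((-1) ^+ M * sform v (A ^+ M.+1 *m e_star K i))).
  apply: eq_bigr => i _; rewrite scale1r [tens _ _]tens_regroup.
  by rewrite -ev_vec2 -IH; apply: (@ev_tens _ _ A 2).
transitivity ((-1) ^+ M * sform v (A ^+ M.+1 *m
    \sum_i (sform (e_ K i) (A *m u) *: e_star K i))).
  rewrite mulmx_sumr linear_sum mulr_sumr; apply: eq_bigr => i _.
  by rewrite -scalemxAr linearZ; apply: mulrCA.
rewrite sum_sform_e_e_star mulmxN linearN mulrN -mulNr (exprS (-1)) mulN1r mulmxA.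
by rewrite [A ^+ M.+2]exprSr -mulmxE.
Qed.

Lemma ev_chain M u v :
  ev A (F 2 _ (basis_hom K (chain_diagram M)) (tens (vec u) (vec v)))
    = (-1) ^+ M * sform v (A ^+ M.+1 *m u).
Proof.
have -> : F 2 _ (basis_hom K (chain_diagram M)) (tens (vec u) (vec v))
    = tens (vec u) (F 1 _ (basis_hom K (tail_diagram M)) (vec v)).
  have := @F_tens _ _ F 1 1 1 _ (Bid K 1) (basis_hom K (tail_diagram M))
    (vec u) (vec v).
  by rewrite F_id id_lfunE Btens_basis.
exact: ev_tail.
Qed.

(** The functor is prescribed only on [e_star i] and [e_ j], so the two arguments are expanded in
    these bases. *)
Lemma F_cup_vec u v :
  F 2 0 (basis_hom K cup_diagram) (tens (vec u) (vec v)) = sform u v *: one_T K n.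
Proof.
have star i : F 2 0 (basis_hom K cup_diagram) (tens (vec (e_star K i)) (vec v))
    = sform (e_star K i) v *: one_T K n.
  rewrite {1}[v]col_sum_e vec_sum tens_sumr linear_sum (bigD1 i) //= big1 ?addr0.
    by rewrite linearZ /= F_cup eqxx scale1r sform_e_star.
  by move=> j /negPf ji; rewrite linearZ /= F_cup eq_sym ji scale0r scaler0.
have uE : u = \sum_i (- sform (e_ K i) u) *: e_star K i.
  under eq_bigr do rewrite scaleNr.
  by rewrite sumrN sum_sform_e_e_star opprK.
rewrite {1}uE vec_sum tens_suml linear_sum.
under eq_bigr do rewrite linearZ /= star.
have -> : sform u v = \sum_i (- sform (e_ K i) u) * sform (e_star K i) v.
  rewrite sformC {1}uE linear_sum -sumrN; apply: eq_bigr => i _.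
  by rewrite [sform (e_star K i) v]sformC mulrN; congr (- _); apply: linearZ.
by rewrite scaler_suml; apply: eq_bigr => i _; rewrite scalerA.
Qed.

Definition tail_arcs M : seq ((nat + nat) * (nat + nat)) :=
  rcons [seq (inr (2 * j)%N, inr (2 * j).+1) | j <- iota 0 M]
    (inr (2 * M)%N, inl 0%N).

Lemma has_arcs_tail M : has_arcs (tail_arcs M) (tail_diagram M).
Proof.
elim: M => [|M IH].
  apply/andP; split=> //; apply/existsP; exists (inr ord0).
  by rewrite mkdiagramE.
have cap_arcs : has_arcs [:: (inr 0, inr 1)]%N cap_diagram.
  apply/andP; split=> //; apply/existsP; exists (inr ord0).
  by rewrite mkdiagramE.
have := has_arcs_juxtapose cap_arcs IH; congr (has_arcs _ _).
rewrite /tail_arcs map_rcons -map_comp /= mulnS (iotaDl 1 0 M) -map_comp.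
congr (_ :: rcons _ _); apply: eq_map => j /=.
by rewrite mulnDr !addSn.
Qed.

Lemma has_arcs_chain M : has_arcs (chain_arcs M.+1) (chain_diagram M).
Proof.
have id_arcs : has_arcs [:: (inl 0, inr 0)]%N (id_diagram 1).
  apply/andP; split=> //; apply/existsP; exists (inl ord0).
  by rewrite mkdiagramE.
have := has_arcs_juxtapose id_arcs (has_arcs_tail M); congr (has_arcs _ _).
rewrite /tail_arcs map_rcons -map_comp /= (iotaDl 1 0 M) -map_comp.
congr (_ :: rcons _ _); last by congr (inr _, _); lia.
by apply: eq_map => j /=; congr (inr _, inr _); lia.
Qed.

(** A cap stacked on top of a chain of length M + 1 joins its first and last lower points, which
    gives the outer arc of a part. Both upper points of the chain go down, so [Bcomp_through]
    applies. *)
Lemma has_arcs_part M :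
  exists2 P : diagram 0 (1 + (M * 2 + 1)), has_arcs (part_arcs 0 M.+1) P &
    Bcomp n (basis_hom K (chain_diagram M)) (basis_hom K cap_diagram)
      = basis_hom K P.
Proof.
have /allP arcs := has_arcs_chain M.
(* The default [ord0] is never reached: the upper points are joined to the first and the last lower
   point. *)
pose f (j : 'I_2) : 'I_(1 + (M * 2 + 1)) :=
  if chain_diagram M (inl j) is inr q then q else ord0.
have [f0 v0] : chain_diagram M (inl ord0) = inr (f ord0) /\ f ord0 = 0%N :> nat.
  have [|[p|p] /andP[]//] := existsP (arcs (inl 0, inr 0)%N _).
    by rewrite inE eqxx.
  case/eqP=> p0 Dp; have -> : ord0 = p by apply: val_inj.
  by rewrite /f; case: (chain_diagram M _) Dp => q //= /eqP[].
have [f1 v1] : chain_diagram M (inl ord_max) = inr (f ord_max)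
    /\ f ord_max = (2 * M).+1 :> nat.
  have [|[p|p] /andP[]//] := existsP (arcs (inr (2 * M.+1).-1, inl 1)%N _).
    by rewrite inE mem_rcons mem_head orbT.
  case/eqP=> pM; case e: (chain_diagram M (inr p)) => [q|q] //= /eqP[q1].
  have -> : ord_max = q by apply: val_inj.
  have qE : chain_diagram M (inl q) = inr p.
    by rewrite -[RHS](partnerK (chain_diagram M)) e.
  by rewrite /f qE; split=> //; rewrite pM; lia.
have fE j : chain_diagram M (inl j) = inr (f j).
  case: (unliftP ord_max j) => [k ->|->] //; rewrite [k]ord1.
  by have -> : lift ord_max 0 = ord0 :> 'I_2 by apply: val_inj.
have fEK j : chain_diagram M (inr (f j)) = inl j by rewrite -fE partnerK.
exists (through_diagram cap_diagram fE); last exact: Bcomp_through.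
rewrite /has_arcs /part_arcs all_rcons; apply/andP; split.
  apply/existsP; exists (inr (f ord0)); rewrite through_diagramE /= fEK.
  rewrite ffunE /= (_ : rev_ord ord0 = ord_max); last exact: val_inj.
  rewrite v0 v1 eqxx /=; apply/eqP; congr inr; lia.
apply/allP => a a_in.
have [|p] := existsP (arcs a _).
  rewrite inE mem_rcons inE; apply/orP; right; apply/orP; right; exact: a_in.
have [j _ ->] := mapP a_in; case: p => p /andP[] //= pj.
case e: (chain_diagram M (inr p)) => [q|q] //= qj.
apply/existsP; exists (inr p); rewrite (through_diagram_inr cap_diagram fE e).
by apply/andP; split.
Qed.

(** The cap feeds [e_ i] and [e_star i] into the two ends of the chain, and pairing [e_star i] with
    the image of [e_ i] under the power of A gives a diagonal entry. *)
Lemma ev_part M (P : diagram 0 (1 + (M * 2 + 1))) :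
  Bcomp n (basis_hom K (chain_diagram M)) (basis_hom K cap_diagram)
    = basis_hom K P ->
  ev A (F 0 _ (basis_hom K P) (one_T K n)) = (-1) ^+ M * \tr (A ^+ M.+1).
Proof.
move=> <-; rewrite F_comp comp_lfunE F_cap !linear_sum mulr_sumr.
apply: eq_bigr => i _; apply: (etrans (ev_chain M _ _)); congr (_ * _).
by rewrite sform_e_star /e_ -colE mxE.
Qed.

End Evaluation.

(** * Evaluation of x_{M,nu} *)

Lemma parts_arcs_rcons o nu l :
  parts_arcs o (rcons nu l) = parts_arcs o nu ++ part_arcs (o + 2 * sumn nu) l.
Proof.
elim: nu o => /= [|a nu IH] o; first by rewrite cats0 muln0 addn0.
by rewrite IH catA mulnDr addnA.
Qed.

Lemma part_arcs_shift k o l :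
  part_arcs o l
    = [seq (shift_point k o a.1, shift_point k o a.2) | a <- part_arcs 0 l].
Proof.
rewrite /part_arcs map_rcons -map_comp /= addn0; congr rcons.
Qed.

(** A part added at the end occupies the rightmost lower points, so the diagram is a juxtaposition;
    hence the induction from the last part in [x_diagram]. *)
Lemma x_arcs_rcons M nu l : let o := ((M + sumn nu) * 2)%N in
  x_arcs M (rcons nu l) = x_arcs M nu ++
    [seq (shift_point 2 o a.1, shift_point 2 o a.2) | a <- part_arcs 0 l].
Proof.
rewrite /= /x_arcs parts_arcs_rcons catA -part_arcs_shift; congr (_ ++ part_arcs _ _).
lia.
Qed.

(** Each even part contributes one sign; together they cancel the factor [(- rho)%:~R ^+ size nu] of
    [kappa] at rho = 1. *)
Lemma prod_sign_even (R : comNzRingType) (t : nat -> R) nu :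
  0%N \notin nu -> all (fun l => ~~ odd l) nu ->
  \prod_(l <- nu) ((-1) ^+ l.-1 * t l) = (-1) ^+ size nu * \prod_(l <- nu) t l.
Proof.
elim: nu => [|l nu IH] /=; first by rewrite !big_nil mulr1.
rewrite inE negb_or => /andP[l0 nu0] /andP[el /(IH nu0) {}IH].
rewrite !big_cons IH.
have -> : (-1) ^+ l.-1 = -1 :> R.
  by rewrite -signr_odd (_ : odd l.-1) //; case: l l0 el => //= l _; rewrite negbK.
by rewrite exprS mulrACA.
Qed.

Section Evaluation.
Variables (K : numFieldType) (n : nat) (F : specialization K n).
Variables (A : 'M[K]_(2 * n)) (spA : in_sp A).
Notation T k := (T K n k).

Definition chain_value M (u v : 'cV[K]_(2 * n)) : K :=
  if M is M'.+1 then (-1) ^+ M' * sform v (A ^+ M *m u) else sform u v.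

(** The length [L] is a variable so that a diagram built by juxtaposition can be transported along
    an equality of arithmetic expressions. *)
Lemma x_diagram M nu L : (0%N \notin nu) -> L = ((M + sumn nu) * 2)%N ->
  exists2 D0 : diagram 2 L, has_arcs (x_arcs M nu) D0 &
    forall u v, ev A (F 2 L (basis_hom K D0) (tens (vec u) (vec v))) =
      chain_value M u v * \prod_(l <- nu) ((-1) ^+ l.-1 * \tr (A ^+ l)).
Proof.
elim/last_ind: nu L => [|nu l IH] L.
  move=> _; rewrite addn0 /x_arcs cats0; case: M => [|M] ->.
    exists cup_diagram => [|u v].
      apply/andP; split=> //; apply/existsP; exists (inl ord0).
      by rewrite mkdiagramE.
    by rewrite F_cup_vec linearZ /= ev_one big_nil.
  have e : ((1 + (M * 2 + 1)) = M.+1 * 2)%N by lia.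
  case: _ / e; exists (chain_diagram M) => [|u v]; first exact: has_arcs_chain.
  by rewrite ev_chain big_nil mulr1.
rewrite mem_rcons inE negb_or sumn_rcons => /andP[l0 nu0].
case: l l0 => // l _ ->.
have e : ((M + sumn nu) * 2 + (1 + (l * 2 + 1))
    = (M + (sumn nu + l.+1)) * 2)%N by lia.
case: _ / e.
have [D0 arcs0 val0] := IH _ nu0 erefl.
have [P arcsP /ev_part valP] := has_arcs_part K n l.
exists (juxtapose D0 P) => [|u v].
  by rewrite x_arcs_rcons; apply: has_arcs_juxtapose.
rewrite -cats1 big_cat big_seq1 [RHS]mulrA -val0.
have := valP F A; rewrite /= => <-; rewrite -ev_tens ?oddM ?andbF //.
have := @F_tens _ _ F 2 _ 0 _ (basis_hom K D0) (basis_hom K P)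
  (tens (vec u) (vec v)) (one_T K n).
by rewrite Btens_basis tens_one_r => <-.
Qed.

Lemma ev_x M nu L u v : (0%N \notin nu) -> L = ((M + sumn nu) * 2)%N ->
  ev A (F 2 L (x_ K M nu L) (tens (vec u) (vec v))) =
      chain_value M u v * \prod_(l <- nu) ((-1) ^+ l.-1 * \tr (A ^+ l)).
Proof.
move=> nu0 LE; have [D0 arcs0 <-] := x_diagram nu0 LE.
(* By [x_arcs_uniq] the indicator function [x_] is supported on the single diagram [D0]. *)
congr (ev A (F 2 L _ _)); apply/ffunP => D; rewrite !ffunE.
congr ((nat_of_bool _)%:R).
move: D0 arcs0; rewrite {}LE in D *; have [D1 h] := x_arcs_uniq M nu0.
by move=> D0; rewrite !h => /eqP->.
Qed.

(** Skew-symmetry of the form makes the cup, the case M = 0, fit the formula of the longer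
    chains. *)
Lemma chain_value_even M u v : ~~ odd M ->
  chain_value M u v = - sform v (A ^+ M *m u).
Proof.
case: M => [|M] /=; first by rewrite expr0 mul1mx sformC.
by rewrite negbK -signr_odd => ->; rewrite mulN1r.
Qed.

(** The super sign turns id + c into u (x) v - v (x) u, on which the skew chain value doubles. *)
Lemma ev_x_wedge M nu L u v : (0%N \notin nu) -> L = ((M + sumn nu) * 2)%N ->
  ~~ odd M -> all (fun l => ~~ odd l) nu ->
  ev A (F 2 L (x_ K M nu L) (F 2 2 (sym2 K 1) (tens (vec u) (vec v)))) =
    - (2%:R * sform v (A ^+ M *m u))
      * ((-1) ^+ size nu * \prod_(l <- nu) \tr (A ^+ l)).
Proof.
move=> nu0 LE eM enu.
rewrite /sym2 scale1r linearD /= add_lfunE [F 2 2 (Bid K 2)]F_id id_lfunE.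
rewrite F_cross_vec.
rewrite linearB /= linearB /= !ev_x // !chain_value_even // -mulrBl.
rewrite [sform u _]sform_exp_even // opprK -opprD -mulr2n -[_ *+ 2]mulr_natl.
by rewrite prod_sign_even.
Qed.

(** * Comparison of kappa with the generating series *)

Lemma polyfun_Fkappa w v1 v2 :
  polyfun (vsval (Fkappa F w (wedge F v1 v2))) A
    = ev A (F 2 (w * 2)%N (kappa K n 1 w)
        (F 2 2 (sym2 K 1) (tens (vec v1) (vec v2)))).
Proof.
rewrite polyfun_ev; congr (ev A _); rewrite /Fkappa /wedge !comp_lfunE !lfunE /=.
(* Both projections act as the identity: the wedge lies in [S2V], and every term of [kappa] ends
   with [s_ w]. *)
rewrite [vsval (vsproj (S2V F) _)]vsprojK; last by rewrite memv_img ?memvf.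
rewrite vsprojK // /kappa linear_sum sum_lfunE rpred_sum // => b _.
rewrite linearZ /= scale_lfunE rpredZ // F_comp comp_lfunE.
by rewrite memv_img ?memvf.
Qed.

Lemma egg_series_partition_sum w v1 v2 :
  egg_series v1 v2 A w
    = \sum_(nu <- bounded_seqs w | is_partition nu && (sumn nu <= w)%N)
        (if odd (w - sumn nu) then 0 else sform v2 (A ^+ (w - sumn nu) *m v1))
          * partition_weight (fun l => \tr (A ^+ l)) nu.
Proof.
(* Partitions are grouped by w - |nu|, the degree taken from the resolvent; the remaining degree
   |nu| comes from the inverse determinant. *)
pose f (nu : seq nat) : 'I_w.+1 := inord (w - sumn nu).
rewrite (partition_big f xpredT) //=; apply: eq_bigr => i _.
rewrite ps_inv_resolvent -(@partition_sum_det _ _ _ w) ?leq_subr //.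
rewrite mulr_sumr; apply: eq_big => nu; last first.
  case/andP=> _ /eqP ->; have le_iw : (i <= w)%N by rewrite -ltnS.
  by rewrite subKn //; case: (odd i) => //; rewrite mul0mx linear0.
have le_iw : (i <= w)%N by rewrite -ltnS.
rewrite -andbA; congr (_ && _); apply/eqP/andP => [e|[le_w /eqP <-]].
  by rewrite /f e leq_subr subKn // inord_val.
by rewrite inordK ?subKn // ltnS leq_subr.
Qed.

(** In the constant, w! 2^w comes from [s_ w], one factor 2 from the coefficient of [x_], another
    from the wedge, and the sign from the chain. *)
Lemma ev_kappa w v1 v2 : ~~ odd w ->
  ev A (F 2 (w * 2)%N (kappa K n 1 w) (F 2 2 (sym2 K 1) (tens (vec v1) (vec v2))))
    = - (4%:R * (w`!)%:R * 2%:R ^+ w) * egg_series v1 v2 A w.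
Proof.
move=> ew; rewrite /kappa linear_sum sum_lfunE linear_sum egg_series_partition_sum.
pose G nu := (-1) ^+ size nu / (centralizer_order nu)%:R
  * ((w`!)%:R * 2%:R ^+ w * (2%:R * ev A (F 2 (w * 2)%N
       (x_ K (w - sumn nu) nu (w * 2)) (F 2 2 (sym2 K 1) (tens (vec v1) (vec v2)))))).
transitivity (\sum_(nu <- bounded_seqs w | Pplus nu && (sumn nu <= w)%N) G nu).
  rewrite /bounded_seqs big_map big_enum_cond; apply: eq_bigr => b _.
  rewrite linearZ /= scale_lfunE linearZ /= F_comp comp_lfunE ev_s //.
  by rewrite [F 2%N _ (2%:R *: _)]linearZ /= scale_lfunE [ev A (2%:R *: _)]linearZ.
rewrite mulr_sumr big_mkcond [RHS]big_mkcond; apply: eq_bigr => nu _ /=.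
rewrite /Pplus; case part: (is_partition nu) => //=.
case le_w: (sumn nu <= w)%N; rewrite ?andbF ?andbT //.
have /andP[_ nu0] := part.
case: ifP => enu; last first.
  (* A partition with an odd part is absent from [kappa], and its weight in the series is 0 because
     the trace of an odd power of A vanishes. *)
  have /allPn[l l_nu] := negbT enu; rewrite negbK => ol.
  rewrite /partition_weight (perm_big _ (perm_to_rem l_nu)) big_cons /=.
  by rewrite mxtrace_exp_odd // !(mul0r, mulr0).
have esum : ~~ odd (sumn nu).
  elim: nu enu {part le_w nu0} => //= l nu IH /andP[el /IH].
  by rewrite oddD (negPf el).
rewrite /G ev_x_wedge //; last 2 first.
- by rewrite subnK.
- by rewrite oddB // (negPf ew) (negPf esum).
rewrite oddB // (negPf ew) (negPf esum) /= /partition_weight.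
transitivity ((-1) ^+ size nu * (-1) ^+ size nu
  * (- (4%:R * (w`!)%:R * 2%:R ^+ w) * (sform v2 (A ^+ (w - sumn nu) *m v1) *
  (\prod_(l <- nu) \tr (A ^+ l) / (centralizer_order nu)%:R)))); last first.
  by rewrite -expr2 sqrr_sign mul1r.
ring.
Qed.

End Evaluation.

Theorem proposition7p10 (R : realType) (n : nat)
    (F : specialization R[i] n) (N : nat) :
  exists2 c : R[i], c != 0 &
    forall (v1 v2 : 'cV[R[i]]_(2 * n)) (A : 'M[R[i]]_(2 * n)), in_sp A ->
      polyfun (vsval (Fkappa F (2 * N) (wedge F v1 v2))) A
        = c * egg_series v1 v2 A (2 * N).
Proof.
exists (- (4%:R * ((2 * N)`!)%:R * 2%:R ^+ (2 * N))).
  by rewrite oppr_eq0 !mulf_neq0 ?expf_neq0 ?pnatr_eq0 // -lt0n fact_gt0.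
move=> v1 v2 A spA.
apply: (etrans (polyfun_Fkappa _ _ _ _ _)).
by apply: ev_kappa; rewrite // oddM.
Qed.
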